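(* Let $U$ be a graph that contains every planar graph. Then (a) the countably infinite complete graph $K_{\aleph_0}$ is a minor of $U$, and (b) $U$ contains a subdivision of $K_t$ for every $t\in\mathbb{N}$.
   Context: All graphs are simple and countable (finite or countably infinite); in particular ''every planar graph'' means every countable planar graph. A graph $G$ contains a graph $H$ if $H$ is isomorphic to a subgraph of $G$. *)

(* Defs.v *)
From Stdlib Require Import Reals List Arith.
Import ListNotations.
Open Scope R_scope.

Record graph : Type := Graph {
  V : Type;
  adj : V -> V -> Prop;
  adj_sym : forall x y, adj x y -> adj y x;
  adj_irrefl : forall x, ~ adj x x;
  V_countable : exists f : V -> nat, forall x y, f x = f y -> x = y
}.

Definition contains (G H : graph) : Prop :=
  exists f : V H -> V G,
    (forall x y, f x = f y -> x = y) /\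
    (forall x y, adj H x y -> adj G (f x) (f y)).

Definition cont_on_unit (g : R -> R * R) : Prop :=
  forall s, 0 <= s <= 1 -> forall eps, 0 < eps -> exists delta, 0 < delta /\
    forall s', 0 <= s' <= 1 -> Rabs (s - s') < delta ->
      Rabs (fst (g s) - fst (g s')) < eps /\ Rabs (snd (g s) - snd (g s')) < eps.

Definition arc (g : R -> R * R) (p q : R * R) : Prop :=
  cont_on_unit g /\
  (forall s s', 0 <= s <= 1 -> 0 <= s' <= 1 -> g s = g s' -> s = s') /\
  g 0 = p /\ g 1 = q.

(** A plane embedding: distinct points for vertices, an arc for every edge
    joining its endpoints, whose interior avoids all vertex points and the
    interiors of the arcs of all other edges. Arcs are indexed by ordered
    pairs; disjointness is required between distinct unordered edges. *)
Definition planar (G : graph) : Prop :=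
  exists (pos : V G -> R * R) (gam : V G -> V G -> R -> R * R),
    (forall x y, pos x = pos y -> x = y) /\
    (forall x y, adj G x y -> arc (gam x y) (pos x) (pos y)) /\
    (forall x y v s, adj G x y -> 0 < s < 1 -> gam x y s <> pos v) /\
    (forall x y x' y' s s', adj G x y -> adj G x' y' ->
       ~ ((x = x' /\ y = y') \/ (x = y' /\ y = x')) ->
       0 < s < 1 -> 0 < s' < 1 -> gam x y s <> gam x' y' s').

Fixpoint walk_adj (G : graph) (l : list (V G)) : Prop :=
  match l with
  | x :: ((y :: _) as l') => adj G x y /\ walk_adj G l'
  | _ => True
  end.

Definition is_path (G : graph) (l : list (V G)) (a b : V G) : Prop :=
  NoDup l /\ walk_adj G l /\ hd_error l = Some a /\ last l a = b /\ l <> [].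

Definition connected_in (G : graph) (B : V G -> Prop) : Prop :=
  forall a b, B a -> B b ->
    exists l, is_path G l a b /\ Forall B l.

(** H is a minor of G (branch-set definition, valid for infinite graphs). *)
Definition minor (H G : graph) : Prop :=
  exists B : V H -> V G -> Prop,
    (forall x, exists u, B x u) /\
    (forall x y u, B x u -> B y u -> x = y) /\
    (forall x, connected_in G (B x)) /\
    (forall x y, adj H x y -> exists u v, B x u /\ B y v /\ adj G u v).

Definition Kinf : graph.
Proof.
  refine (Graph nat (fun x y => x <> y) _ _ _).
  - intros x y H. congruence.
  - intros x H. apply H; reflexivity.
  - exists (fun n => n). auto.
Defined.

Definition interior {T : Type} (l : list T) : list T := removelast (tl l).

Definition contains_subdivision_K (G : graph) (t : nat) : Prop :=
  exists (f : nat -> V G) (P : nat -> nat -> list (V G)),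
    (forall i j, (i < t)%nat -> (j < t)%nat -> f i = f j -> i = j) /\
    (forall i j, (i < j < t)%nat -> is_path G (P i j) (f i) (f j)) /\
    (forall i j k, (i < j < t)%nat -> (k < t)%nat -> ~ In (f k) (interior (P i j))) /\
    (forall i j i' j' v, (i < j < t)%nat -> (i' < j' < t)%nat -> (i, j) <> (i', j') ->
       In v (interior (P i j)) -> ~ In v (interior (P i' j'))).

(* Main.v *)
(**
  The planar graphs used are triangulated spirals: vertex [a] is joined to
  [a + 1] and to its children [N a, ..., N a + N - 1] in the next turn, and the
  quadrilateral [a], [a + 1], [N (a + 1) - 1], [N (a + 1)] gets one of its two
  diagonals according to a bit of [al : nat -> bool].  There are uncountably
  many bit sequences but [U] is countable, so some embedding of a spiral is a
  limit of embeddings of different spirals.  Two spirals whose embeddings agree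
  up to a late vertex and then differ yield a jump: a path of [U] that avoids
  one of the two images and joins two vertices that are not adjacent in it.  In
  the limit, [U] contains a triangulated spiral with infinitely many disjoint
  jumps.

  Bunched strands running outwards along the lines [N^n * a] can be rotated
  around the spiral, and a jump lets two cyclically consecutive strands cross.
  Hence any two strands can be made to touch.  Infinitely many strands started
  one after the other give the minor; strands started at the children of [t]
  consecutive vertices, with [N >= t], give the subdivision.
*)

(* In a plane spiral the cyclic order of outgoing strands is fixed, so only neighbours could ever
   touch. Each jump buys one transposition, and transpositions with rotations reach every pair.
   Infinitely many jumps are needed because each crossing uses up the jump it is routed through.

   The obstacle in the limit is that a jump must keep avoiding the image while the embedding still
   changes. Agreement up to a level therefore covers, besides bits and images, which vertices of [U]
   of small rank are used at all. A disagreement gives a jump over one of the two embeddings, and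
   which one cannot be chosen; since both bit sequences are condensation points, the construction
   goes on with the one that has the jump.

   The obstacle in the routing is that the ends of a jump are known only to be nonadjacent in the
   spiral: they may lie on strands, in one turn or many turns apart. Three disjoint positions of the
   bunch leave one that both ends miss, and then a partner edge, or a detour within one turn, lets
   the two strands cross. *)
Require Import Defs.
From Stdlib Require Import Reals List Arith.
From Stdlib Require Import Lia Lra Classical ClassicalEpsilon FunctionalExtensionality.
From Stdlib Require Import Cantor.
Import ListNotations.
Open Scope nat_scope.

(** * Connected sets and paths *)

(** Walks inside [S] that may repeat vertices: they concatenate freely, and repetitions are removed
    only once, in [conn_path]. *)
Inductive conn {T : Type} (R : T -> T -> Prop) (S : T -> Prop) : T -> T -> Prop :=
| conn_refl a : S a -> conn R S a a
| conn_step a b c : S a -> R a b -> conn R S b c -> conn R S a c.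

Definition connected {T : Type} (R : T -> T -> Prop) (S : T -> Prop) : Prop :=
  forall a b, S a -> S b -> conn R S a b.

Lemma conn_left {T} (R : T -> T -> Prop) S a b : conn R S a b -> S a.
Proof. intros H; destruct H; auto. Qed.

Lemma conn_edge {T} (R : T -> T -> Prop) (S : T -> Prop) a b :
  S a -> S b -> R a b -> conn R S a b.
Proof. intros; eapply conn_step; eauto using conn_refl. Qed.

Lemma conn_mono {T} (R : T -> T -> Prop) (S S' : T -> Prop) a b :
  (forall x, S x -> S' x) -> conn R S a b -> conn R S' a b.
Proof. intros HS H; induction H; eauto using conn_refl, conn_step. Qed.

Lemma conn_trans {T} (R : T -> T -> Prop) S a b c :
  conn R S a b -> conn R S b c -> conn R S a c.
Proof. induction 1; eauto using conn_step. Qed.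

Lemma conn_sym {T} (R : T -> T -> Prop) S a b :
  (forall x y, R x y -> R y x) -> conn R S a b -> conn R S b a.
Proof.
  intros HR; induction 1; [now apply conn_refl|].
  eapply conn_trans; [eassumption|].
  apply conn_edge; auto. eapply conn_left; eauto.
Qed.

Lemma connected_root {T} (R : T -> T -> Prop) (S : T -> Prop) r :
  (forall x y, R x y -> R y x) ->
  (forall v, S v -> conn R S v r) -> connected R S.
Proof.
  intros HR H a b Ha Hb.
  eapply conn_trans; [now apply H|]. apply conn_sym; auto.
Qed.

Lemma connected_join {T} (R : T -> T -> Prop) (S S' : T -> Prop) p q :
  (forall x y, R x y -> R y x) -> connected R S -> connected R S' ->
  S p -> S' q -> p = q \/ R p q -> connected R (fun v => S v \/ S' v).
Proof.
  intros HR HS HS' Hp Hq Hpq.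
  apply (connected_root _ _ p HR).
  intros v [Hv|Hv].
  - eapply conn_mono; [|apply HS; eauto]. auto.
  - assert (H : conn R (fun v => S v \/ S' v) v q)
      by (eapply conn_mono; [|apply HS'; eauto]; auto).
    destruct Hpq as [->|Hpq]; [exact H|].
    eapply conn_trans; [exact H|]. apply conn_edge; auto.
Qed.

Lemma walk_adj_cons (G : graph) a b l :
  walk_adj G (a :: b :: l) <-> adj G a b /\ walk_adj G (b :: l).
Proof. reflexivity. Qed.

Lemma last_indep {T} (l : list T) a b : l <> [] -> last l a = last l b.
Proof.
  intros Hl. destruct (exists_last Hl) as (l' & c & ->). now rewrite !last_last.
Qed.

Lemma is_path_suffix (G : graph) l1 x l2 a b :
  is_path G (l1 ++ x :: l2) a b -> is_path G (x :: l2) x b.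
Proof.
  revert a; induction l1 as [|c l1 IH]; intros a (Hn & Hw & Hh & Hl & _).
  - simpl in *. injection Hh as ->. repeat split; auto; discriminate.
  - destruct (l1 ++ x :: l2) as [|d l'] eqn:E; [destruct l1; discriminate|].
    simpl app in *. rewrite E in *. apply (IH d).
    repeat split; try discriminate.
    + now inversion Hn.
    + apply Hw.
    + rewrite <- Hl. simpl. destruct l'; auto.
      now apply last_indep.
Qed.

Lemma conn_path (G : graph) (S : V G -> Prop) a b :
  conn (adj G) S a b -> exists l, is_path G l a b /\ Forall S l.
Proof.
  induction 1 as [a Ha | a c b Ha Hac _ (l & Hl & HS)].
  - exists [a]. repeat split; auto; try discriminate. repeat constructor; auto.
  (* If [a] already lies on the path, the suffix from [a] on replaces it, which removes the loop. *)
  - destruct (classic (In a l)) as [Hin|Hin].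
    + apply in_split in Hin as (l1 & l2 & ->).
      exists (a :: l2). split; [eapply is_path_suffix; eauto|].
      apply Forall_app in HS. tauto.
    + exists (a :: l). split; [|now constructor].
      destruct l as [|d l]; [destruct Hl as (_ & _ & _ & _ & Hl); congruence|].
      destruct Hl as (Hn & Hw & Hh & Hl & _). injection Hh as ->.
      repeat split; auto; try discriminate.
      * now constructor.
      * rewrite <- Hl. simpl. destruct l; auto.
        now apply last_indep.
Qed.

Lemma connected_connected_in (G : graph) (S : V G -> Prop) :
  connected (adj G) S -> connected_in G S.
Proof. intros H a b Ha Hb. apply conn_path, H; auto. Qed.

Lemma path_interior (G : graph) l a b v :
  is_path G l a b -> In v (Defs.interior l) -> In v l /\ v <> a /\ v <> b.
Proof.
  intros (Hn & _ & Hh & Hl & _) Hv.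
  destruct l as [|c l]; [destruct Hv|]. injection Hh as ->.
  unfold Defs.interior in Hv; simpl in Hv.
  destruct l as [|d l _] using rev_ind; [destruct Hv|].
  rewrite removelast_last in Hv.
  rewrite app_comm_cons, last_last in Hl. subst d.
  inversion Hn as [|? ? Ha Hn']; subst.
  apply NoDup_remove in Hn' as [_ Hb]. rewrite app_nil_r in Hb.
  repeat split.
  - right; apply in_or_app; auto.
  - intros ->. apply Ha, in_or_app; auto.
  - intros ->. auto.
Qed.

(** * Spirals are planar *)

(** From [a = 3] on, [a + 1 < N * a - 1], so the four kinds of edge never coincide; 0, 1 and 2 are
    isolated. The last case is the other diagonal of the quadrilateral governed by [al (a - 1)],
    read from its later inner corner. *)
Definition sedge (N : nat) (al : nat -> bool) (a b : nat) : Prop :=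
  2 <= N /\ 3 <= a /\
  (b = a + 1 \/ N * a <= b < N * a + N \/
   (b = N * a + N /\ al a = true) \/ (b + 1 = N * a /\ al (a - 1) = false)).

Definition sadj (N : nat) (al : nat -> bool) (a b : nat) : Prop :=
  sedge N al a b \/ sedge N al b a.

Lemma sedge_lt N al a b : sedge N al a b -> a < b.
Proof. unfold sedge; nia. Qed.

Lemma sadj_sym N al a b : sadj N al a b -> sadj N al b a.
Proof. unfold sadj; tauto. Qed.

Lemma sadj_irrefl N al a : ~ sadj N al a a.
Proof. intros [H|H]; apply sedge_lt in H; lia. Qed.

Definition spiral (N : nat) (al : nat -> bool) : graph :=
  Graph nat (sadj N al) (sadj_sym N al) (sadj_irrefl N al)
    (ex_intro _ (fun n => n) (fun x y H => H)).

Open Scope R_scope.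

(* The plane minus the origin is the strip [0 < X], [0 <= u < 1]: the argument
   is [log_N X] turns and the radius grows from [X/N] at [u = 0] to [X] at
   [u = 1], so that [(X, 1)] and [(N X, 0)] are the same point. *)
Definition band (N X u : R) : R * R :=
  (X * ((1 - u) / N + u) * cos (2 * PI * (ln X / ln N)),
   X * ((1 - u) / N + u) * sin (2 * PI * (ln X / ln N))).

Lemma cos_1_period x : cos x = 1 -> exists k : Z, x = 2 * IZR k * PI.
Proof.
  intros H. destruct (sin_eq_0_0 (x / 2)) as [k Hk].
  - replace x with (2 * (x / 2)) in H by field. rewrite cos_2a_sin in H.
    assert (E : sin (x / 2) * sin (x / 2) = 0) by lra.
    apply Rmult_integral in E. tauto.
  - exists k. lra.
Qed.

Lemma polar_inj r r' t t' :
  0 < r -> 0 < r' -> r * cos t = r' * cos t' -> r * sin t = r' * sin t' ->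
  r = r' /\ exists k : Z, t - t' = 2 * IZR k * PI.
Proof.
  intros Hr Hr' Hc Hs.
  pose proof (sin2_cos2 t) as H1. pose proof (sin2_cos2 t') as H2.
  unfold Rsqr in *.
  assert (E : r * r = r' * r').
  { replace (r * r) with ((r * cos t) * (r * cos t) + (r * sin t) * (r * sin t))
      by (transitivity (r * r * (sin t * sin t + cos t * cos t)); [ring|rewrite H1; ring]).
    rewrite Hc, Hs.
    transitivity (r' * r' * (sin t' * sin t' + cos t' * cos t')); [ring|rewrite H2; ring]. }
  assert (r = r') by nra. subst r'. split; auto.
  apply Rmult_eq_reg_l in Hc; [|lra]. apply Rmult_eq_reg_l in Hs; [|lra].
  apply cos_1_period. rewrite cos_minus, Hc, Hs. lra.
Qed.

Lemma radius_bounds N X u :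
  1 < N -> 0 < X -> 0 <= u < 1 -> X <= N * (X * ((1 - u) / N + u)) /\
  0 < X * ((1 - u) / N + u) < X.
Proof.
  intros HN HX Hu.
  assert (E : N * (X * ((1 - u) / N + u)) = X * ((1 - u) + N * u)) by (field; lra).
  assert (H1 : X * 1 <= X * ((1 - u) + N * u)) by (apply Rmult_le_compat_l; nra).
  assert (H2 : (1 - u) / N < 1 - u).
  { apply (Rmult_lt_reg_l N); [lra|].
    replace (N * ((1 - u) / N)) with (1 - u) by (field; lra). nra. }
  split; [lra|]. split; nra.
Qed.

(** Equal arguments make [X / X'] an integral power of [N]. The common radius lies in [[X/N, X)] and
    in [[X'/N, X')], so this ratio is strictly between [1/N] and [N] and the power is 0. *)
Lemma band_inj N X X' u u' :
  1 < N -> 0 < X -> 0 < X' -> 0 <= u < 1 -> 0 <= u' < 1 ->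
  band N X u = band N X' u' -> X = X' /\ u = u'.
Proof.
  intros HN HX HX' Hu Hu' E. unfold band in E. injection E as E1 E2.
  destruct (radius_bounds N X u HN HX Hu) as [B1 B2].
  destruct (radius_bounds N X' u' HN HX' Hu') as [B1' B2'].
  destruct (polar_inj _ _ _ _ (proj1 B2) (proj1 B2') E1 E2) as [Er [k Hk]].
  assert (HlN : 0 < ln N) by (rewrite <- ln_1; apply ln_increasing; lra).
  pose proof PI_RGT_0 as HPI.
  assert (Hl : ln X - ln X' = IZR k * ln N).
  { apply (Rmult_eq_reg_l (2 * PI / ln N)).
    - transitivity (2 * PI * (ln X / ln N) - 2 * PI * (ln X' / ln N)).
      + field; lra.
      + rewrite Hk. field; lra.
    - apply Rgt_not_eq. apply Rdiv_lt_0_compat; lra. }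
  assert (far : forall Y Y' (m : Z), 0 < Y -> 0 < Y' -> (0 < m)%Z ->
            ln Y - ln Y' = IZR m * ln N -> N * Y' <= Y).
  { intros Y Y' m HY HY' Hm H.
    assert (1 <= IZR m) by (apply (IZR_le 1); lia).
    destruct (Rle_lt_dec (N * Y') Y) as [?|C]; auto.
    apply ln_increasing in C; auto. rewrite ln_mult in C by lra. nra. }
  destruct (Z.lt_trichotomy k 0) as [Hk0|[Hk0|Hk0]].
  - assert (H := far X' X (- k)%Z HX' HX ltac:(lia)).
    rewrite opp_IZR in H. specialize (H ltac:(lra)). nra.
  - subst k. assert (X = X') by (apply ln_inv; lra). subst X'. split; auto.
    apply Rmult_eq_reg_l in Er; [|lra].
    assert (E' : (u - u') * (1 - / N) = 0) by (unfold Rdiv in Er; lra).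
    assert (/ N < 1) by (rewrite <- Rinv_1; apply Rinv_lt_contravar; lra).
    apply Rmult_integral in E'. lra.
  - assert (H := far X X' k HX HX' ltac:(lia) Hl). nra.
Qed.

Lemma band_neq_0 N X u :
  1 < N -> 0 < X -> 0 <= u < 1 -> band N X u <> (0, 0).
Proof.
  intros HN HX Hu E. unfold band in E. injection E as E1 E2.
  destruct (radius_bounds N X u HN HX Hu) as [_ [B _]].
  set (t := 2 * PI * (ln X / ln N)) in *.
  pose proof (sin2_cos2 t) as H. unfold Rsqr in H.
  apply Rmult_integral in E1. apply Rmult_integral in E2. nra.
Qed.

Lemma band_wrap N X : 1 < N -> 0 < X -> band N X 1 = band N (N * X) 0.
Proof.
  intros HN HX. unfold band.
  assert (HlN : 0 < ln N) by (rewrite <- ln_1; apply ln_increasing; lra).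
  rewrite ln_mult by lra.
  replace (2 * PI * ((ln N + ln X) / ln N)) with (2 * PI * (ln X / ln N) + 2 * PI)
    by (field; lra).
  rewrite cos_plus, sin_plus, cos_2PI, sin_2PI.
  f_equal; field; lra.
Qed.

Lemma cont_on_unit_pt (g : R -> R * R) :
  (forall s, 0 <= s <= 1 -> continuity_pt (fun s => fst (g s)) s /\
                            continuity_pt (fun s => snd (g s)) s) ->
  cont_on_unit g.
Proof.
  intros H s Hs eps Heps. destruct (H s Hs) as [H1 H2].
  destruct (H1 eps Heps) as [d1 [P1 Q1]]. destruct (H2 eps Heps) as [d2 [P2 Q2]].
  exists (Rmin d1 d2). split; [now apply Rmin_glb_lt|].
  intros s' Hs' Hd.
  destruct (Req_dec s s') as [<-|Hne].
  - rewrite !Rminus_diag, Rabs_R0. auto.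
  - assert (D : D_x no_cond s s') by (split; [exact I|auto]).
    split; rewrite Rabs_minus_sym.
    + apply Q1. split; [exact D|]. simpl. unfold Rdist.
      rewrite Rabs_minus_sym. eapply Rlt_le_trans; [exact Hd|apply Rmin_l].
    + apply Q2. split; [exact D|]. simpl. unfold Rdist.
      rewrite Rabs_minus_sym. eapply Rlt_le_trans; [exact Hd|apply Rmin_r].
Qed.

Lemma band_cont N (X u : R -> R) :
  1 < N -> (forall s, 0 <= s <= 1 -> 0 < X s) ->
  (forall s, continuity_pt X s) -> (forall s, continuity_pt u s) ->
  cont_on_unit (fun s => band N (X s) (u s)).
Proof.
  intros HN HX CX Cu. apply cont_on_unit_pt. intros s Hs. unfold band; simpl.
  assert (Cr : continuity_pt (fun s => X s * ((1 - u s) / N + u s)) s).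
  { apply (continuity_pt_mult X (fun s => (1 - u s) / N + u s)); auto.
    apply (continuity_pt_plus (fun s => (1 - u s) * / N) u); auto.
    apply (continuity_pt_mult (fun s => 1 - u s) (fun _ => / N)).
    - apply (continuity_pt_minus (fun _ => 1) u); auto.
      apply continuity_pt_const; red; auto.
    - apply continuity_pt_const; red; auto. }
  assert (Ct : continuity_pt (fun s => 2 * PI * (ln (X s) / ln N)) s).
  { apply (continuity_pt_mult (fun _ => 2 * PI) (fun s => ln (X s) * / ln N)).
    - apply continuity_pt_const; red; auto.
    - apply (continuity_pt_mult (fun s => ln (X s)) (fun _ => / ln N)).
      + apply (continuity_pt_comp X ln); auto.
        apply derivable_continuous_pt. exists (/ X s). apply derivable_pt_lim_ln; auto.
      + apply continuity_pt_const; red; auto. }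
  split.
  - apply (continuity_pt_mult (fun s => X s * ((1 - u s) / N + u s))
             (fun s => cos (2 * PI * (ln (X s) / ln N)))); auto.
    apply (continuity_pt_comp (fun s => 2 * PI * (ln (X s) / ln N)) cos); auto.
    apply continuity_cos.
  - apply (continuity_pt_mult (fun s => X s * ((1 - u s) / N + u s))
             (fun s => sin (2 * PI * (ln (X s) / ln N)))); auto.
    apply (continuity_pt_comp (fun s => 2 * PI * (ln (X s) / ln N)) sin); auto.
    apply continuity_sin.
Qed.

Lemma arc_rev g p q : arc g p q -> arc (fun s => g (1 - s)) q p.
Proof.
  intros (Hc & Hi & H0 & H1). repeat split.
  - intros s Hs eps He. destruct (Hc (1 - s) ltac:(lra) eps He) as (d & Hd & H).
    exists d. split; auto. intros s' Hs' Hss. apply H; [lra|].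
    replace (1 - s - (1 - s')) with (- (s - s')) by ring. now rewrite Rabs_Ropp.
  - intros s s' Hs Hs' E. apply Hi in E; lra.
  - now replace (1 - 0) with 1 by ring.
  - now replace (1 - 1) with 0 by ring.
Qed.

(** Radius [a], argument [log_N a] turns up to a full turn. For [a = 0] the factor [X] is 0, so this
    isolated vertex sits at the origin whatever the value of [ln 0]. *)
Definition spos (N a : nat) : R * R := band (INR N) (INR (N * a)) 0.

(** In the strip, the edge to [a + 1] runs along the line [u = 0]. Every other edge is the segment
    from [(N * a, 0)] to [(b, 1)], which is the point [(N * b, 0)] of vertex [b] by [band_wrap]. *)
Definition sarc (N a b : nat) (s : R) : R * R :=
  if Nat.eq_dec b (a + 1) then band (INR N) (INR (N * a) + INR N * s) 0
  else band (INR N) ((1 - s) * INR (N * a) + s * INR b) s.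

Lemma spos_inj N a b : (2 <= N)%nat -> spos N a = spos N b -> a = b.
Proof.
  intros HN E. unfold spos in E.
  assert (HN' : 1 < INR N) by (apply (lt_INR 1); lia).
  assert (E0 : band (INR N) (INR (N * 0)) 0 = (0, 0))
    by (rewrite Nat.mul_0_r; unfold band; simpl; f_equal; ring).
  assert (P : forall c, c <> 0%nat -> 0 < INR (N * c)) by (intros; apply lt_0_INR; nia).
  destruct (Nat.eq_dec a 0) as [->|Ha], (Nat.eq_dec b 0) as [->|Hb]; auto.
  - rewrite E0 in E. symmetry in E. apply band_neq_0 in E; auto; [easy|lra].
  - rewrite E0 in E. apply band_neq_0 in E; auto; [easy|lra].
  - apply band_inj in E; auto; try lra. destruct E as [E _]. apply INR_eq in E. nia.
Qed.

Lemma sarc_band N al a b s : sedge N al a b -> 0 <= s < 1 ->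
  exists X u, 0 < X /\ 0 <= u < 1 /\ sarc N a b s = band (INR N) X u /\
   ((b = a + 1)%nat /\ X = INR (N * a) + INR N * s /\ u = 0 \/
    (b <> a + 1)%nat /\ X = (1 - s) * INR (N * a) + s * INR b /\ u = s).
Proof.
  intros Hab Hs. pose proof (sedge_lt _ _ _ _ Hab) as Hlt.
  destruct Hab as (HN & Ha & _).
  assert (0 < INR N) by (apply lt_0_INR; lia).
  assert (0 < INR (N * a)) by (apply lt_0_INR; nia).
  assert (0 < INR b) by (apply lt_0_INR; lia).
  unfold sarc. destruct (Nat.eq_dec b (a + 1)).
  - exists (INR (N * a) + INR N * s), 0. repeat split; auto; try lra; nra.
  - exists ((1 - s) * INR (N * a) + s * INR b), s. repeat split; auto; try lra; nra.
Qed.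

Lemma sarc_0 N a b : sarc N a b 0 = spos N a.
Proof.
  unfold sarc, spos. destruct (Nat.eq_dec b (a + 1)); f_equal; ring.
Qed.

Lemma sarc_1 N al a b : sedge N al a b -> sarc N a b 1 = spos N b.
Proof.
  intros Hab. pose proof (sedge_lt _ _ _ _ Hab) as Hlt.
  destruct Hab as (HN & Ha & _).
  unfold sarc, spos. destruct (Nat.eq_dec b (a + 1)) as [->|].
  - f_equal. rewrite Rmult_1_r, <- plus_INR. f_equal. lia.
  - replace ((1 - 1) * INR (N * a) + 1 * INR b) with (INR b) by ring.
    rewrite band_wrap, mult_INR; auto.
    + apply (lt_INR 1); lia.
    + apply lt_0_INR; lia.
Qed.

Lemma sarc_avoid N al a b s c : sedge N al a b -> 0 < s < 1 ->
  sarc N a b s <> spos N c.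
Proof.
  intros Hab Hs E.
  assert (HN : (2 <= N)%nat) by apply Hab.
  assert (HN' : 1 < INR N) by (apply (lt_INR 1); lia).
  destruct (sarc_band N al a b s Hab ltac:(lra)) as (X & u & HX & Hu & E' & H).
  rewrite E' in E. unfold spos in E.
  destruct (Nat.eq_dec c 0) as [->|Hc].
  { revert E. replace (band (INR N) (INR (N * 0)) 0) with (0, 0).
    - apply band_neq_0; auto.
    - rewrite Nat.mul_0_r; unfold band; simpl; f_equal; ring. }
  apply band_inj in E; auto; try lra.
  - destruct E as [EX Eu]. destruct H as [(_ & HXs & _)|(_ & _ & Hus)]; [|lra].
    (* Inside a successor edge [X] lies strictly between the consecutive multiples [N * a] and
       [N * a + N], where there is no vertex. *)
    assert (L1 : (N * a < N * c)%nat) by (apply INR_lt; nra).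
    assert (L2 : (N * c < N * a + N)%nat)
      by (apply INR_lt; rewrite plus_INR; nra).
    apply Nat.mul_lt_mono_pos_l in L1; [|lia]. nia.
  - apply lt_0_INR; nia.
Qed.

(* Two edges that are not of the form [a, a+1] leave the inner turn and reach
   the outer turn in the same order, so their straight lifts do not cross. *)
Lemma sedge_order N al a b a' b' :
  sedge N al a b -> sedge N al a' b' -> (b <> a + 1)%nat -> (b' <> a' + 1)%nat ->
  (a < a')%nat -> (b <= b')%nat.
Proof.
  intros (HN & _ & H) (_ & _ & H') Hb Hb' Haa.
  destruct (Nat.eq_dec a' (a + 1)) as [->|].
  - replace (a + 1 - 1)%nat with a in H' by lia.
    destruct H as [?|[?|[[? ?]|[? ?]]]], H' as [?|[?|[[? ?]|[? ?]]]];
      try congruence; nia.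
  - assert (N * a + 2 * N <= N * a')%nat by nia.
    lia.
Qed.

(** The height [u] separates the two kinds of arcs. Two arcs of the second kind can meet only at
    equal height, where [sedge_order] keeps the one that starts first strictly behind. *)
Lemma sarc_cross N al a b a' b' s s' :
  sedge N al a b -> sedge N al a' b' -> 0 < s < 1 -> 0 < s' < 1 ->
  sarc N a b s = sarc N a' b' s' -> a = a' /\ b = b'.
Proof.
  intros Hab Hab' Hs Hs' E.
  assert (HN : (2 <= N)%nat) by apply Hab.
  assert (HN' : 1 < INR N) by (apply (lt_INR 1); lia).
  destruct (sarc_band N al a b s Hab ltac:(lra)) as (X & u & HX & Hu & E1 & H).
  destruct (sarc_band N al a' b' s' Hab' ltac:(lra)) as (X' & u' & HX' & Hu' & E2 & H').
  rewrite E1, E2 in E. apply band_inj in E; auto. destruct E as [EX Eu].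
  destruct H as [(Hb & HXs & Hus)|(Hb & HXs & Hus)],
    H' as [(Hb' & HXs' & Hus')|(Hb' & HXs' & Hus')]; try lra.
  - assert (L1 : (N * a < N * a' + N)%nat) by (apply INR_lt; rewrite plus_INR; nra).
    assert (L2 : (N * a' < N * a + N)%nat) by (apply INR_lt; rewrite plus_INR; nra).
    assert (a < a' + 1)%nat by nia. assert (a' < a + 1)%nat by nia. lia.
  - assert (s = s') by lra. subst s' u u'.
    assert (ord : forall c d c' d', sedge N al c d -> sedge N al c' d' ->
       (d <> c + 1)%nat -> (d' <> c' + 1)%nat -> (c < c')%nat ->
       (1 - s) * INR (N * c) + s * INR d < (1 - s) * INR (N * c') + s * INR d').
    { intros c d c' d' G G' Hd Hd' Hcc.
      assert (INR d <= INR d') by (eapply le_INR, sedge_order; eauto).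
      assert (INR (N * c) < INR (N * c')) by (apply lt_INR; nia).
      nra. }
    destruct (Nat.lt_trichotomy a a') as [L|[L|L]].
    + specialize (ord _ _ _ _ Hab Hab' Hb Hb' L). lra.
    + subst a'. split; auto. apply INR_eq. nra.
    + specialize (ord _ _ _ _ Hab' Hab Hb' Hb L). lra.
Qed.

Lemma continuity_affine p q s : continuity_pt (fun s => p + q * s) s.
Proof.
  apply (continuity_pt_plus (fun _ => p) (fun s => q * s)).
  - apply continuity_pt_const; red; auto.
  - apply (continuity_pt_mult (fun _ => q) (fun s => s)).
    + apply continuity_pt_const; red; auto.
    + apply derivable_continuous_pt, derivable_pt_id.
Qed.

Lemma sarc_arc N al a b : sedge N al a b -> arc (sarc N a b) (spos N a) (spos N b).
Proof.
  intros Hab. pose proof (sedge_lt _ _ _ _ Hab) as Hlt.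
  assert (HN : (2 <= N)%nat) by apply Hab.
  assert (Ha : (3 <= a)%nat) by apply Hab.
  assert (HN' : 1 < INR N) by (apply (lt_INR 1); lia).
  assert (P1 : 0 < INR (N * a)) by (apply lt_0_INR; nia).
  assert (P2 : 0 < INR b) by (apply lt_0_INR; lia).
  repeat split.
  - unfold sarc. destruct (Nat.eq_dec b (a + 1)).
    + apply (band_cont (INR N) (fun s => INR (N * a) + INR N * s) (fun _ => 0)); auto.
      * intros; nra.
      * intros; apply continuity_affine.
      * intros; apply continuity_pt_const; red; auto.
    + apply (band_cont (INR N) (fun s => (1 - s) * INR (N * a) + s * INR b) (fun s => s));
        auto.
      * intros; nra.
      * intros s. replace (fun s => (1 - s) * INR (N * a) + s * INR b)
          with (fun s => INR (N * a) + (INR b - INR (N * a)) * s)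
          by (apply functional_extensionality; intros; ring).
        apply continuity_affine.
      * intros; apply derivable_continuous_pt, derivable_pt_id.
  - assert (end1 : forall s, 0 <= s < 1 -> sarc N a b s <> spos N b).
    { intros s Hs E. destruct (Req_dec s 0) as [->|].
      - rewrite sarc_0 in E. apply spos_inj in E; lia.
      - revert E. apply (sarc_avoid N al); auto; lra. }
    assert (mid : forall s s', 0 <= s < 1 -> 0 <= s' < 1 ->
              sarc N a b s = sarc N a b s' -> s = s').
    { intros s s' Hs Hs' E.
      destruct (sarc_band N al a b s Hab Hs) as (X & u & HX & Hu & E1 & H).
      destruct (sarc_band N al a b s' Hab Hs') as (X' & u' & HX' & Hu' & E2 & H').
      rewrite E1, E2 in E. apply band_inj in E; auto. destruct E as [EX Eu].
      destruct H as [(Hb & HXs & Hus)|(Hb & HXs & Hus)],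
        H' as [(Hb' & HXs' & Hus')|(Hb' & HXs' & Hus')]; try lia; nra. }
    intros s s' Hs Hs' E.
    destruct (Req_dec s 1) as [->|], (Req_dec s' 1) as [->|]; auto.
    + rewrite (sarc_1 N al) in E by auto. symmetry in E. exfalso. revert E.
      apply end1; lra.
    + rewrite (sarc_1 N al) in E by auto. exfalso. revert E. apply end1; lra.
    + apply mid; auto; lra.
  - apply sarc_0.
  - now apply (sarc_1 N al).
Qed.

Lemma spiral_planar N al : (2 <= N)%nat -> planar (spiral N al).
Proof.
  intros HN.
  exists (spos N), (fun a b s => if lt_dec a b then sarc N a b s else sarc N b a (1 - s)).
  assert (or : forall a b, sadj N al a b -> (a < b)%nat /\ sedge N al a b \/
                                            (b < a)%nat /\ sedge N al b a).
  { intros a b [H|H]; pose proof (sedge_lt _ _ _ _ H); auto. }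
  simpl. split; [|split; [|split]].
  - intros a b. now apply spos_inj.
  - intros a b H. destruct (or _ _ H) as [[L E]|[L E]]; destruct (lt_dec a b); try lia.
    + now apply (sarc_arc N al).
    + now apply arc_rev, (sarc_arc N al).
  - intros a b v s H Hs. destruct (or _ _ H) as [[L E]|[L E]];
      destruct (lt_dec a b); try lia.
    + now apply (sarc_avoid N al).
    + apply (sarc_avoid N al); auto; lra.
  - intros a b a' b' s s' H H' Hne Hs Hs' E. apply Hne.
    destruct (or _ _ H) as [[L G]|[L G]]; destruct (or _ _ H') as [[L' G']|[L' G']];
      destruct (lt_dec a b), (lt_dec a' b'); try lia;
      eapply (sarc_cross N al) in E; eauto; lra || lia.
Qed.

Open Scope nat_scope.

(** * Diverging embeddings *)

Lemma dependent_choice {T : Type} (inv : T -> Prop) (rel : T -> T -> Prop) :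
  (forall s, inv s -> exists s', inv s' /\ rel s s') ->
  forall s0, inv s0 ->
  exists q : nat -> T, q 0 = s0 /\ forall n, inv (q n) /\ rel (q n) (q (n + 1)).
Proof.
  intros Hstep s0 H0.
  set (next := fun s : {s : T | inv s} =>
    let w := constructive_indefinite_description _ (Hstep (proj1_sig s) (proj2_sig s)) in
    exist inv (proj1_sig w) (proj1 (proj2_sig w))).
  set (q := fix q n := match n with 0 => exist inv s0 H0 | S n => next (q n) end).
  exists (fun n => proj1_sig (q n)). split; [reflexivity|].
  intros n. split; [apply (proj2_sig (q n))|].
  replace (n + 1) with (S n) by lia. simpl. unfold next.
  destruct constructive_indefinite_description as (s' & Hi & Hr). exact Hr.
Qed.

Lemma least_nat (P : nat -> Prop) n : P n -> exists m, P m /\ forall k, k < m -> ~ P k.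
Proof.
  induction n as [n IH] using lt_wf_ind. intros Hn.
  destruct (classic (exists k, k < n /\ P k)) as [(k & Hk & HP)|H]; [eauto|].
  exists n. split; auto. intros k Hk HP. apply H; eauto.
Qed.

Fixpoint prefix_code (f : nat -> nat) (M : nat) : nat :=
  match M with 0 => 0 | S M => to_nat (prefix_code f M, f M) end.

Lemma prefix_code_eq f g M :
  prefix_code f M = prefix_code g M -> forall k, k < M -> f k = g k.
Proof.
  induction M as [|M IH]; intros H k Hk; [lia|].
  cbn [prefix_code] in H. apply (f_equal of_nat) in H. rewrite !cancel_of_to in H.
  injection H as H1 H2. destruct (Nat.eq_dec k M) as [->|]; auto. apply IH; auto; lia.
Qed.

(* [D] is the set of condensation points of [e] in the Baire space. *)
Lemma condensation {X : Type} (x0 : X) (e : X -> nat -> nat) :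
  (forall a : nat -> X, exists x, forall n, exists k, e x k <> e (a n) k) ->
  exists D : X -> Prop, (exists x, D x) /\
    forall x, D x -> forall M, exists y, D y /\
      (forall k, k < M -> e x k = e y k) /\ exists k, e x k <> e y k.
Proof.
  intros Hunc.
  (* A cylinder is small if one sequence lists all its points. [enum] picks such a list and [A] runs
     through the lists for all [M] and [c]. For other cylinders the list is arbitrary, which removes
     only countably many more points. *)
  set (covers := fun M c (a : nat -> X) =>
    forall x, prefix_code (e x) M = c -> exists n, forall k, e x k = e (a n) k).
  set (enum := fun M c => epsilon (inhabits (fun _ : nat => x0)) (covers M c)).
  set (A := fun t => let (p, n) := of_nat t in let (M, c) := of_nat p in enum M c n).
  exists (fun x => forall n, exists k, e x k <> e (A n) k).
  split; [apply Hunc|].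
  intros x Hx M. apply NNPP. intros Hno.
  set (c := prefix_code (e x) M).
  assert (Hc : covers M c (enum M c)).
  { apply epsilon_spec.
    (* With no other point of [D] in it, the cylinder of [x] is listed by [x] followed by [A]; so it
       is small and [A] meets the point [x], against [D x]. *)
    exists (fun n => match n with 0 => x | S n => A n end).
    intros y Hy. apply NNPP. intros Hy'. apply Hno. exists y. repeat split.
    - intros n. apply NNPP. intros H. apply Hy'. exists (S n).
      intros k. apply NNPP. intros Hk. apply H. eauto.
    - apply prefix_code_eq. now rewrite Hy.
    - apply NNPP. intros H. apply Hy'. exists 0.
      intros k. apply NNPP. intros Hk. apply H. eauto. }
  destruct (Hc x eq_refl) as [n Hn].
  destruct (Hx (to_nat (to_nat (M, c), n))) as [k Hk].
  apply Hk. unfold A. rewrite !cancel_of_to. apply Hn.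
Qed.

(** * Jumps from two embeddings that disagree *)

Definition embeds (U : graph) (N : nat) (al : nat -> bool) (f : nat -> V U) : Prop :=
  (forall x y, f x = f y -> x = y) /\
  (forall x y, sadj N al x y -> adj U (f x) (f y)).

(** An empty [l] is allowed. The bound [M <= rank y] will keep the paths of different jumps
    disjoint, since each level exceeds the ranks on the earlier paths. *)
Definition is_jump (U : graph) (rank : V U -> nat) (N : nat) (al : nat -> bool)
    (f : nat -> V U) (M x z : nat) (l : list (V U)) : Prop :=
  x < z /\ ~ sadj N al x z /\ walk_adj U (f x :: l ++ [f z]) /\
  forall y, In y l -> (forall k, f k <> y) /\ M <= rank y.

(** The last clause freezes which vertices of [U] of rank below [M] are used; without it a later
    embedding could run through the path of an earlier jump. *)
Definition agree (U : graph) (rank : V U -> nat) (M : nat)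
    (al be : nat -> bool) (f g : nat -> V U) : Prop :=
  forall k, k < M -> al k = be k /\ f k = g k /\
    ((exists i, rank (f i) = k) <-> (exists i, rank (g i) = k)).

Lemma sadj_lt N al a b : a < b -> sadj N al a b -> sedge N al a b.
Proof. intros H [E|E]; auto. apply sedge_lt in E. lia. Qed.

Lemma spiral_succ N al a : 2 <= N -> 3 <= a -> sadj N al a (a + 1).
Proof. intros; left; unfold sedge; auto. Qed.

Lemma spiral_child N al a r : 2 <= N -> 3 <= a -> r < N -> sadj N al a (N * a + r).
Proof. intros; left; unfold sedge. repeat split; auto. lia. Qed.

Lemma spiral_parent N al j : 2 <= N -> 3 * N <= j -> sadj N al (j / N) j.
Proof.
  intros HN Hj. pose proof (Nat.div_mod_eq j N) as E.
  pose proof (Nat.mod_upper_bound j N ltac:(lia)) as B.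
  rewrite E at 2. apply spiral_child; auto.
  apply Nat.div_le_lower_bound; lia.
Qed.

Lemma parent_bounds N j : 2 <= N -> 3 * N <= j ->
  3 <= j / N /\ N * (j / N) <= j < N * (j / N) + N.
Proof.
  intros HN Hj. pose proof (Nat.div_mod_eq j N).
  pose proof (Nat.mod_upper_bound j N ltac:(lia)).
  split; [apply Nat.div_le_lower_bound; lia|lia].
Qed.

(* The triangle on [j - 1] and the parent of [j] is filled by [j] only. *)
Lemma no_other_apex N al j z : 2 <= N -> 5 * N <= j -> j < z ->
  ~ sadj N al (j - 1) z \/ ~ sadj N al (j / N) z.
Proof.
  intros HN Hj Hz. destruct (parent_bounds N j HN ltac:(lia)) as [Hp1 Hp2].
  set (p := j / N) in *.
  destruct (classic (sadj N al (j - 1) z)) as [H1|]; auto. right. intros H2.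
  apply sadj_lt in H1; [|lia]. apply sadj_lt in H2; [|nia].
  assert (p + 3 <= j) by nia.
  assert (z <= N * p + N) by (unfold sedge in H2; nia).
  assert (N * (j - 1) - 1 <= z) by (unfold sedge in H1; lia).
  assert (N * (p + 2) <= N * (j - 1)) by (apply Nat.mul_le_mono_l; lia).
  lia.
Qed.

Lemma walk_map (U : graph) (g : nat -> V U) n : forall a u v,
  adj U u (g a) -> (forall i, a <= i < a + n -> adj U (g i) (g (i + 1))) ->
  adj U (g (a + n)) v -> walk_adj U (u :: map g (seq a (S n)) ++ [v]).
Proof.
  induction n as [|n IH]; intros a u v H1 H2 H3.
  - rewrite Nat.add_0_r in H3. simpl. auto.
  - change (seq a (S (S n))) with (a :: seq (S a) (S n)). simpl map.
    rewrite <- app_comm_cons. apply walk_adj_cons. split; auto.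
    apply IH.
    + replace (S a) with (a + 1) by lia. apply H2; lia.
    + intros i Hi. apply H2; lia.
    + replace (S a + n) with (a + S n) by lia. auto.
Qed.

Lemma jump_into_image U rank N M al be f g j z :
  2 <= N -> embeds U N al f -> embeds U N be g -> 5 * N <= j ->
  (forall i, i < j -> f i = g i) -> z <> j -> g j = f z ->
  exists x z l, j / N <= x /\ is_jump U rank N al f M x z l.
Proof.
  intros HN [If Ef] [Ig Eg] Hj Hfg Hz E.
  destruct (parent_bounds N j HN ltac:(lia)) as [Hp1 Hp2].
  set (p := j / N) in *.
  assert (Hpj : p + 3 <= j) by nia.
  assert (Hjz : j < z).
  { destruct (Nat.lt_trichotomy z j) as [L|[L|L]]; try lia.
    rewrite (Hfg z L) in E. apply Ig in E. lia. }
  destruct (no_other_apex N al j z HN Hj Hjz) as [Hn|Hn].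
  - exists (j - 1), z, []. split; [lia|]. repeat split; try easy; try lia.
    rewrite (Hfg (j - 1)), <- E by lia. apply Eg.
    replace j with (j - 1 + 1) at 2 by lia. apply spiral_succ; lia.
  - exists p, z, []. split; [lia|]. repeat split; try easy; try lia.
    rewrite (Hfg p), <- E by lia. apply Eg. apply spiral_parent; lia.
Qed.

(** The successors of [j] under [g] are followed until they meet the image of [f], necessarily at a
    vertex later than [j], or reach the first child of [j / N + 2], a vertex on which [f] and [g]
    agree. In the second case the jump joins [j / N] to [j / N + 2]. *)
Lemma jump_off_image U rank N M al be f g j :
  (forall u v, rank u = rank v -> u = v) ->
  2 <= N -> embeds U N al f -> embeds U N be g -> agree U rank M al be f g ->
  5 * N <= j -> (forall i, i < j -> f i = g i) ->
  (forall z, g j <> f z) -> (forall z, f j <> g z) ->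
  exists x z l, j / N <= x /\ is_jump U rank N al f M x z l.
Proof.
  intros Hr HN [If Ef] [Ig Eg] Hag Hj Hfg Hgj Hfj.
  destruct (parent_bounds N j HN ltac:(lia)) as [Hp1 Hp2].
  set (p := j / N) in *.
  assert (Hpj : p + 3 <= j) by nia.
  assert (Hnew : forall i, (forall z, g i <> f z) -> M <= rank (g i)).
  { intros i Hi. destruct (le_lt_dec M (rank (g i))) as [|L]; auto. exfalso.
    destruct (proj2 (proj2 (proj2 (Hag _ L)))) as [z Hz]; eauto.
    apply (Hi z). symmetry; auto. }
  destruct (least_nat (fun t => (exists z, g (j + t) = f z) \/ j + t = N * (p + 2))
              (N * (p + 2) - j)) as (t & Ht & Hmin); [right; nia|].
  assert (Hbefore : forall i, j <= i < j + t -> forall z, g i <> f z).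
  { intros i Hi z E. apply (Hmin (i - j)); [lia|]. left. exists z.
    now replace (j + (i - j)) with i by lia. }
  assert (Hwalk : forall u v n, adj U u (g j) -> adj U (g (j + n)) v ->
                    walk_adj U (u :: map g (seq j (S n)) ++ [v])).
  { intros u v n H1 H2. apply walk_map; auto.
    intros i Hi. apply Eg, spiral_succ; lia. }
  destruct (classic (exists z, g (j + t) = f z)) as [(z & E)|Hnone].
  - assert (t <> 0) by (intros ->; apply (Hgj z); now rewrite <- E, Nat.add_0_r).
    assert (Hjz : j < z).
    { destruct (Nat.lt_trichotomy z j) as [L|[L|L]]; auto.
      - rewrite (Hfg z L) in E. apply Ig in E. lia.
      - subst z. now destruct (Hfj (j + t)). }
    assert (Hl : forall x, x < z -> ~ sadj N al x z -> adj U (f x) (g j) ->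
        is_jump U rank N al f M x z (map g (seq j t))).
    { intros x Hx Hnx Hxj. repeat split; auto.
      - replace t with (S (t - 1)) at 1 by lia. apply Hwalk; auto.
        rewrite <- E. replace (j + t) with (j + (t - 1) + 1) by lia.
        apply Eg, spiral_succ; lia.
      - apply in_map_iff in H0 as (i & <- & Hin). apply in_seq in Hin.
        intros k Ek. now apply (Hbefore i Hin k).
      - apply in_map_iff in H0 as (i & <- & Hin). apply in_seq in Hin. auto. }
    destruct (no_other_apex N al j z HN Hj Hjz) as [Hn|Hn].
    + exists (j - 1), z, (map g (seq j t)). split; [lia|]. apply Hl; auto; [lia|].
      rewrite Hfg by lia. apply Eg.
      replace j with (j - 1 + 1) at 2 by lia. apply spiral_succ; lia.
    + exists p, z, (map g (seq j t)). split; [lia|]. apply Hl; auto; [lia|].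
      rewrite Hfg by lia. apply Eg. apply spiral_parent; lia.
  - destruct Ht as [Ht|Ht]; [tauto|].
    exists p, (p + 2), (map g (seq j (S t))). split; [lia|].
    assert (Hb : forall i, j <= i < j + S t -> forall z, g i <> f z).
    { intros i Hi z E. destruct (Nat.eq_dec i (j + t)) as [->|]; eauto.
      apply (Hbefore i ltac:(lia) z E). }
    split; [lia|split; [|split]].
    (* [5 * N <= j] gives [p >= 5], so [p + 2] lies before [N * p - 1], the first possible outer
       neighbour of [p]. *)
    + intros H. apply sadj_lt in H; [|lia]. unfold sedge in H. nia.
    + apply Hwalk.
      * rewrite Hfg by lia. apply Eg, spiral_parent; lia.
      * rewrite (Hfg (p + 2)), Ht by lia. apply Eg, sadj_sym.
        rewrite <- (Nat.add_0_r (N * (p + 2))). apply spiral_child; lia.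
    + intros y Hy. apply in_map_iff in Hy as (i & <- & Hin). apply in_seq in Hin.
      split; [|auto]. intros k Ek. now apply (Hb i Hin k).
Qed.

(** With equal embeddings, the diagonal that only [be] has is an edge of [U] between two vertices
    nonadjacent in the spiral of [al]. *)
Lemma jump_from_bits U rank N M al be f g :
  (forall u v, rank u = rank v -> u = v) ->
  2 <= N -> embeds U N al f -> embeds U N be g -> agree U rank M al be f g ->
  5 * N <= M -> (forall k, f k = g k) -> (exists k, al k <> be k) ->
  exists x z l, M / N <= x /\ is_jump U rank N al f M x z l.
Proof.
  intros Hr HN [If Ef] [Ig Eg] Hag HM Hfg [k Hk].
  assert (HkM : M <= k).
  { destruct (le_lt_dec M k) as [|L]; auto. destruct (Hk (proj1 (Hag k L))). }
  assert (M / N <= M) by (apply Nat.Div0.div_le_upper_bound; nia).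
  assert (Hj : forall x z, M / N <= x -> x < z -> ~ sadj N al x z -> sadj N be x z ->
      exists x z l, M / N <= x /\ is_jump U rank N al f M x z l).
  { intros x z H1 H2 H3 H4. exists x, z, []. split; auto.
    repeat split; try easy. rewrite !Hfg. auto. }
  destruct (al k) eqn:Ea, (be k) eqn:Eb; try congruence.
  - apply (Hj (k + 1) (N * (k + 1) - 1)); try nia.
    + intros H1. apply sadj_lt in H1; [|nia]. destruct H1 as (_ & _ & H1).
      replace (k + 1 - 1) with k in H1 by lia.
      destruct H1 as [?|[?|[[? ?]|[? ?]]]]; try congruence; nia.
    + left. repeat split; try lia. right; right; right.
      replace (k + 1 - 1) with k by lia. split; auto; nia.
  - apply (Hj k (N * k + N)); try nia.
    + intros H1. apply sadj_lt in H1; [|nia]. destruct H1 as (_ & _ & H1).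
      destruct H1 as [?|[?|[[? ?]|[? ?]]]]; try congruence; nia.
    + left. repeat split; try lia; auto.
Qed.

(** At the first difference [j], either [g j] is in the image of [f], or [f j] is in the image of
    [g], or neither holds. The second case yields a jump over [g] only, hence the disjunction. *)
Lemma jump_of_disagreement U rank N M al be f g :
  (forall u v, rank u = rank v -> u = v) ->
  2 <= N -> embeds U N al f -> embeds U N be g -> agree U rank M al be f g ->
  5 * N <= M -> (exists k, f k <> g k) \/ (exists k, al k <> be k) ->
  exists x z l, M / N <= x /\
    (is_jump U rank N al f M x z l \/ is_jump U rank N be g M x z l).
Proof.
  intros Hr HN Hf Hg Hag HM Hne.
  destruct (classic (exists k, f k <> g k)) as [[k0 Hk0]|Heq].
  - destruct (least_nat (fun k => f k <> g k) _ Hk0) as (j & Hj & Hmin).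
    assert (Hfg : forall i, i < j -> f i = g i).
    { intros i Hi. apply NNPP, Hmin, Hi. }
    assert (HMj : M <= j).
    { destruct (le_lt_dec M j) as [|L]; auto. destruct (Hj (proj1 (proj2 (Hag j L)))). }
    assert (Hd : M / N <= j / N) by (apply Nat.Div0.div_le_mono; lia).
    destruct (classic (exists z, g j = f z)) as [[z Hz]|Hno1].
    { destruct (jump_into_image U rank N M al be f g j z) as (x & z' & l & H1 & H2);
        auto; [lia| |exists x, z', l; split; auto; lia].
      intros ->. auto. }
    destruct (classic (exists z, f j = g z)) as [[z Hz]|Hno2].
    { destruct (jump_into_image U rank N M be al g f j z) as (x & z' & l & H1 & H2);
        auto; [lia|intros; symmetry; auto| |exists x, z', l; split; auto; lia].
      intros ->. auto. }
    destruct (jump_off_image U rank N M al be f g j) as (x & z' & l & H1 & H2);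
      eauto; [lia|exists x, z', l; split; auto; lia].
  - assert (Hfg : forall k, f k = g k) by (intros k; apply NNPP; eauto).
    destruct Hne as [Hne|Hne]; [tauto|].
    destruct (jump_from_bits U rank N M al be f g) as (x & z & l & H1 & H2); eauto 6.
Qed.

Lemma list_rank_bound {T} (rank : T -> nat) (l : list T) :
  exists b, forall y, In y l -> rank y < b.
Proof.
  induction l as [|a l [b IH]]; [exists 0; easy|].
  exists (S (rank a + b)). intros y [<-|Hy]; [lia|]. specialize (IH y Hy). lia.
Qed.

Lemma agree_mono U rank M M' al be f g :
  M' <= M -> agree U rank M al be f g -> agree U rank M' al be f g.
Proof. intros HM H k Hk. apply H; lia. Qed.

Lemma agree_trans U rank M al be ga f g h :
  agree U rank M al be f g -> agree U rank M be ga g h -> agree U rank M al ga f h.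
Proof.
  intros H1 H2 k Hk.
  destruct (H1 k Hk) as (E1 & E2 & E3), (H2 k Hk) as (F1 & F2 & F3).
  repeat split; try congruence; tauto.
Qed.

(** The code of [al] records bits, ranks of images and usage flags, so that a common prefix of codes
    is exactly what [agree] asks. Cantor's diagonal argument on the bits shows that no sequence
    lists all codes. *)
Lemma condensed_embeddings U rank N :
  (forall u v : V U, rank u = rank v -> u = v) ->
  (forall G, planar G -> contains U G) -> 2 <= N ->
  exists (F : (nat -> bool) -> nat -> V U) (D : (nat -> bool) -> Prop),
    (forall al, embeds U N al (F al)) /\ (exists al, D al) /\
    (forall al, D al -> forall M, exists be, D be /\
       agree U rank M al be (F al) (F be) /\
       ((exists k, F al k <> F be k) \/ exists k, al k <> be k)).
Proof.
  intros Hr HU HN.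
  assert (HF : forall al, {f | embeds U N al f}).
  { intros al. apply constructive_indefinite_description.
    destruct (HU (spiral N al) (spiral_planar N al HN)) as (f & H1 & H2).
    exists f. split; auto. }
  set (F := fun al => proj1_sig (HF al)).
  set (used := fun al k =>
    if excluded_middle_informative (exists i, rank (F al i) = k) then 1 else 0).
  set (e := fun (al : nat -> bool) k =>
    to_nat ((if al k then 1 else 0), to_nat (rank (F al k), used al k))).
  assert (He : forall al be k, e al k = e be k ->
     al k = be k /\ F al k = F be k /\
     ((exists i, rank (F al i) = k) <-> (exists i, rank (F be i) = k))).
  { intros al be k E. unfold e in E.
    apply (f_equal of_nat) in E. rewrite !cancel_of_to in E. apply pair_equal_spec in E as [E1 E2].
    apply (f_equal of_nat) in E2. rewrite !cancel_of_to in E2. apply pair_equal_spec in E2 as [E2 E3].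
    repeat split.
    - destruct (al k), (be k); congruence.
    - auto.
    - unfold used in E3. do 2 destruct excluded_middle_informative; tauto || easy.
    - unfold used in E3. do 2 destruct excluded_middle_informative; tauto || easy. }
  destruct (condensation (fun _ => true) e) as (D & HD1 & HD2).
  { intros a. exists (fun n => negb (a n n)). intros n. exists n. intros E.
    apply He in E as [E _]. destruct (a n n); discriminate. }
  exists F, D. repeat split; auto.
  - apply (proj2_sig (HF al)).
  - apply (proj2_sig (HF al)).
  - intros al Hal M. destruct (HD2 al Hal M) as (be & Hbe & H1 & k & Hk).
    exists be. split; [auto|]. split.
    + intros i Hi. apply He, H1, Hi.
    + apply NNPP. intros Hno. apply Hk. unfold e, used.
      assert (Ef : F al = F be).
      { apply functional_extensionality. intros i. apply NNPP. eauto. }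
      assert (Ea : al = be).
      { apply functional_extensionality. intros i. apply NNPP. eauto. }
      now rewrite Ea.
Qed.

(** * The limit of a sequence of spirals *)

Record stage (U : graph) : Type := Stage {
  bits : nat -> bool; level : nat; jfrom : nat; jto : nat; jvia : list (V U)
}.
Arguments bits {U}. Arguments level {U}. Arguments jfrom {U}. Arguments jto {U}.
Arguments jvia {U}.

Theorem spiral_with_jumps U N :
  (forall G, planar G -> contains U G) -> 2 <= N ->
  exists (ga : nat -> bool) (f : nat -> V U) (X Z : nat -> nat) (L : nat -> list (V U)),
    embeds U N ga f /\
    (forall n, X n < Z n < X (n + 1)) /\
    (forall n, ~ sadj N ga (X n) (Z n)) /\
    (forall n, walk_adj U (f (X n) :: L n ++ [f (Z n)])) /\
    (forall n y, In y (L n) -> forall k, f k <> y) /\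
    (forall n m y, In y (L n) -> In y (L m) -> n = m).
Proof.
  intros HU HN. destruct (V_countable U) as [rank Hr].
  destruct (condensed_embeddings U rank N Hr HU HN) as (F & D & HF & [al0 Hal0] & HD).
  (* The next jump starts at [level s / N] or later; the last bound makes this lie beyond the end of
     the current jump. *)
  set (inv := fun s : stage U => D (bits s) /\ 5 * N <= level s /\
                N * (jto s + 1) <= level s).
  set (rel := fun s s' : stage U =>
    agree U rank (level s) (bits s) (bits s') (F (bits s)) (F (bits s')) /\
    level s < level s' /\ jto s < jfrom s' /\
    is_jump U rank N (bits s') (F (bits s')) (level s) (jfrom s') (jto s') (jvia s') /\
    jto s' + 1 < level s' /\ forall y, In y (jvia s') -> rank y < level s').
  destruct (dependent_choice inv rel) with (s0 := Stage U al0 (5 * N) 0 0 [])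
    as (q & _ & Hq).
  { intros [al M x0 z0 l0] (H1 & H2 & H3). simpl in H1, H2, H3.
    destruct (HD al H1 M) as (be & Hbe & Hag & Hne).
    assert (Hdiv : z0 < M / N).
    { apply (Nat.lt_le_trans _ (z0 + 1)); [lia|].
      apply Nat.div_le_lower_bound; lia. }
    destruct (jump_of_disagreement U rank N M al be (F al) (F be)) as (x & z & l & Hx & HJ); auto.
    destruct (list_rank_bound rank l) as [b Hb].
    (* The new level exceeds the old one, both ends of the jump and all ranks on its path, so later
       stages leave the jump intact; [N * (z + 1)] restores the invariant. *)
    set (M' := M + 1 + N * (z + 1) + z + 2 + b).
    assert (Hgo : exists ga, D ga /\ agree U rank M al ga (F al) (F ga) /\
                    is_jump U rank N ga (F ga) M x z l).
    { destruct HJ as [HJ|HJ]; [exists al|exists be]; (split; [auto|split; [|exact HJ]]); auto.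
      intros k _. repeat split; auto. }
    destruct Hgo as (ga & Hga & Hag' & HJ').
    exists (Stage U ga M' x z l). unfold inv, rel; simpl.
    split; [split; [auto|lia]|]. split; [auto|].
    split; [lia|]. split; [lia|]. split; [auto|]. split; [lia|].
    intros y Hy. specialize (Hb y Hy). lia. }
  { unfold inv; simpl. repeat split; auto; lia. }
  assert (Hlev : forall n m, n <= m -> level (q n) + (m - n) <= level (q m)).
  { intros n m Hnm. induction Hnm as [|m Hnm IH]; [lia|].
    destruct (Hq m) as [_ (_ & Hl & _)]. rewrite Nat.add_1_r in Hl. lia. }
  assert (Hk : forall k, k < level (q k)) by (intros k; destruct (Hq 0) as [(_ & H & _) _];
                                            specialize (Hlev 0 k); lia).
  assert (Hag : forall n m, n <= m -> agree U rank (level (q n)) (bits (q n)) (bits (q m))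
                                        (F (bits (q n))) (F (bits (q m)))).
  { intros n m Hnm. induction Hnm as [|m Hnm IH].
    - intros k _. repeat split; auto.
    - eapply agree_trans; [exact IH|]. destruct (Hq m) as [_ [H _]].
      rewrite Nat.add_1_r in H. eapply agree_mono; [|exact H].
      specialize (Hlev n m Hnm). lia. }
  (* Since [k < level (q k)], entry [k] is final from stage [k] on. *)
  set (ga := fun k => bits (q k) k). set (f := fun k => F (bits (q k)) k).
  assert (Hlim : forall k n, k < level (q n) -> ga k = bits (q n) k /\ f k = F (bits (q n)) k).
  { intros k n Hkn. destruct (Nat.le_ge_cases k n) as [L|L].
    - destruct (Hag k n L k (Hk k)) as (E1 & E2 & _). auto.
    - destruct (Hag n k L k Hkn) as (E1 & E2 & _). auto. }
  assert (Hsadj : forall n a b, a < level (q n) -> b < level (q n) ->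
            sadj N ga a b <-> sadj N (bits (q n)) a b).
  { intros n a b Ha Hb. unfold sadj, sedge.
    rewrite !(proj1 (Hlim _ n Ha)), !(proj1 (Hlim _ n Hb)).
    rewrite (proj1 (Hlim (a - 1) n ltac:(lia))), (proj1 (Hlim (b - 1) n ltac:(lia))).
    tauto. }
  assert (Hjump : forall n y, In y (jvia (q (n + 1))) ->
            (forall k, f k <> y) /\ level (q n) <= rank y < level (q (n + 1))).
  { intros n y Hy. destruct (Hq n) as [_ (_ & _ & _ & (_ & _ & _ & HJ) & _ & HL)].
    destruct (HJ y Hy) as [Hy1 Hy2]. specialize (HL y Hy). split; [|lia].
    intros k Ek.
    assert (Hn : n + 1 <= n + 1 + k) by lia.
    assert (Hkk : k < level (q (n + 1 + k))) by (specialize (Hk k); specialize (Hlev k (n+1+k)); lia).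
    rewrite (proj2 (Hlim k (n + 1 + k) Hkk)) in Ek.
    (* If the limit used the path vertex [y], so would a late stage; as [rank y] is below the level
       of stage [n + 1], that stage would use [y] too, but its jump avoids its image. *)
    destruct (Hag _ _ Hn (rank y) HL) as (_ & _ & H).
    destruct (proj2 H) as [i Hi]; [exists k; now rewrite Ek|].
    apply Hr in Hi. now apply (Hy1 i). }
  exists ga, f, (fun n => jfrom (q (n + 1))), (fun n => jto (q (n + 1))),
    (fun n => jvia (q (n + 1))).
  split; [split|split; [|split; [|split; [|split]]]].
  - intros a b E. set (n := a + b).
    assert (a < level (q n)) by (specialize (Hk a); specialize (Hlev a n); lia).
    assert (b < level (q n)) by (specialize (Hk b); specialize (Hlev b n); lia).
    rewrite (proj2 (Hlim a n ltac:(auto))), (proj2 (Hlim b n ltac:(auto))) in E.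
    now apply (proj1 (HF (bits (q n)))).
  - intros a b E. set (n := a + b).
    assert (Ha : a < level (q n)) by (specialize (Hk a); specialize (Hlev a n); lia).
    assert (Hb : b < level (q n)) by (specialize (Hk b); specialize (Hlev b n); lia).
    rewrite (proj2 (Hlim a n Ha)), (proj2 (Hlim b n Hb)).
    apply HF. now apply Hsadj.
  - intros n. destruct (Hq n) as [_ (_ & _ & _ & (H & _) & _)].
    destruct (Hq (n + 1)) as [_ (_ & _ & H' & _)]. lia.
  - intros n. destruct (Hq n) as [_ (_ & _ & _ & (H0 & H & _) & H1 & _)].
    rewrite Hsadj; [exact H| |]; lia.
  - intros n. destruct (Hq n) as [_ (_ & _ & _ & (H0 & _ & H & _) & H1 & _)].
    rewrite !(fun k h => proj2 (Hlim k (n + 1) h)) by lia. exact H.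
  - intros n y Hy. apply (Hjump n y Hy).
  - intros n m y Hn Hm. apply Hjump in Hn as [_ Hn]. apply Hjump in Hm as [_ Hm].
    destruct (Nat.lt_trichotomy n m) as [L|[L|L]]; auto.
    + specialize (Hlev (n + 1) m ltac:(lia)). lia.
    + specialize (Hlev (m + 1) n ltac:(lia)). lia.
Qed.

(** * Strands on a spiral with jumps *)

(** The routing sees only this relation on numbers, where jumps count as edges. The alternatives
    place [z] relative to the outer neighbours [N * x - 1, ..., N * x + N] of [x]; at the two
    extreme ones nonadjacency forces the opposite diagonal. *)
Record jump_grid (N : nat) (R : nat -> nat -> Prop) : Prop := JumpGrid {
  jg_N : 2 <= N;
  jg_sym : forall a b, R a b -> R b a;
  jg_succ : forall a, 3 <= a -> R a (a + 1);
  jg_child : forall a r, 3 <= a -> r < N -> R a (N * a + r);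
  jg_jump : forall M, exists x z, M <= x /\ x + 2 <= z /\ R x z /\
    (z + 1 < N * x \/ (z + 1 = N * x /\ R (x - 1) (N * x)) \/
     (z = N * x + N /\ R (x + 1) (N * x + N - 1)) \/ N * x + N < z)
}.

(* Strand [sg j] (for [j < k]) has reached [N^n * (g + j)]; the branch sets [B]
   do not meet the future [>= N^n * g] except in these ends. *)
Definition config (N : nat) (R : nat -> nat -> Prop) (lb n g k : nat)
    (sg : nat -> nat) (B : nat -> nat -> Prop) : Prop :=
  k + 3 <= g /\ lb <= N ^ n * g /\
  (forall i j, i < k -> j < k -> sg i = sg j -> i = j) /\
  (forall j, j < k -> connected R (B (sg j)) /\ B (sg j) (N ^ n * (g + j)) /\
     forall v, B (sg j) v -> lb <= v /\ (N ^ n * g <= v -> v = N ^ n * (g + j))) /\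
  (forall i j v, i < k -> j < k -> B (sg i) v -> B (sg j) v -> i = j).

Lemma connected_ext {T} (R : T -> T -> Prop) (A B : T -> Prop) :
  (forall v, A v <-> B v) -> connected R A -> connected R B.
Proof.
  intros E H a b Ha Hb. apply (conn_mono R A); [intros; now apply E|].
  apply H; now apply E.
Qed.

(** [D j] continues the strand in slot [j] from its end, and new slot [j] is filled from old slot
    [rho j]. Old branch sets meet the future only in their ends, so only the continuations need to
    be pairwise disjoint. *)
Lemma config_extend N R lb n g k sg B n' g' sg' (rho : nat -> nat) (D : nat -> nat -> Prop) :
  (forall a b, R a b -> R b a) ->
  config N R lb n g k sg B ->
  k + 3 <= g' -> N ^ n * g <= N ^ n' * g' ->
  (forall j, j < k -> rho j < k /\ sg' j = sg (rho j)) ->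
  (forall i j, i < k -> j < k -> rho i = rho j -> i = j) ->
  (forall j, j < k -> connected R (D j) /\ D j (N ^ n * (g + j)) /\
                      forall v, D j v -> N ^ n * g <= v) ->
  (forall i j v, i < k -> j < k -> D i v -> D j v -> i = j) ->
  (forall j, j < k -> D (rho j) (N ^ n' * (g' + j)) /\
     forall v, D (rho j) v -> N ^ n' * g' <= v -> v = N ^ n' * (g' + j)) ->
  exists B', (forall i v, B i v -> B' i v) /\
             (forall j v, j < k -> D j v -> B' (sg j) v) /\
             config N R lb n' g' k sg' B'.
Proof.
  intros Hsym (Hg & Hlb & Hinj & HB & Hdisj) Hg' Hnn Hrho Hri HD HDd HDe.
  exists (fun i v => B i v \/ exists j, j < k /\ sg j = i /\ D j v).
  assert (E : forall j v, j < k ->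
    (B (sg j) v \/ (exists j0, j0 < k /\ sg j0 = sg j /\ D j0 v)) <-> (B (sg j) v \/ D j v)).
  { intros j v Hj. split; [|intros [?|?]; eauto].
    intros [?|(j0 & Hj0 & Es & ?)]; auto.
    apply Hinj in Es; auto. subst j0. auto. }
  split; [|split]; [auto|eauto|].
  split; [auto|]. split; [lia|]. split; [|split].
  - intros i j Hi Hj Es. destruct (Hrho i Hi) as [Hi' Ei], (Hrho j Hj) as [Hj' Ej].
    apply Hri; auto. apply Hinj; auto. congruence.
  - intros j Hj. destruct (Hrho j Hj) as [Hj' ->].
    destruct (HB _ Hj') as (C1 & C2 & C3), (HD _ Hj') as (D1 & D2 & D3),
      (HDe j Hj) as (F1 & F2).
    split; [|split].
    + eapply connected_ext; [intros v; symmetry; now apply E|].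
      apply (connected_join R _ _ (N ^ n * (g + rho j)) (N ^ n * (g + rho j))); auto.
    + apply E; auto.
    + intros v Hv. apply E in Hv; auto. destruct Hv as [Hv|Hv].
      * split; [now apply C3|]. intros Hle. apply F2; auto.
        rewrite (proj2 (C3 v Hv)) by lia. auto.
      * split; [specialize (D3 v Hv); lia|]. auto.
  - intros i j v Hi Hj Hvi Hvj.
    destruct (Hrho i Hi) as [Hi' Ei], (Hrho j Hj) as [Hj' Ej].
    rewrite Ei in Hvi. rewrite Ej in Hvj. apply E in Hvi, Hvj; auto.
    apply Hri; auto.
    destruct (HB _ Hi') as (_ & _ & Ci), (HB _ Hj') as (_ & _ & Cj).
    destruct (HD _ Hi') as (_ & Si & Di), (HD _ Hj') as (_ & Sj & Dj).
    destruct Hvi as [Hvi|Hvi], Hvj as [Hvj|Hvj].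
    + eauto.
    + apply (HDd _ _ v); auto.
      rewrite (proj2 (Ci v Hvi)) by auto. auto.
    + apply (HDd _ _ v); auto.
      rewrite (proj2 (Cj v Hvj)) by auto. auto.
    + eauto.
Qed.

Lemma config_same_strands N R lb n g k sg sg' B :
  (forall j, j < k -> sg' j = sg j) ->
  config N R lb n g k sg B -> config N R lb n g k sg' B.
Proof.
  intros E (Hg & Hlb & Hi & HB & Hd). split; [auto|]. split; [auto|].
  split; [|split].
  - intros i j H1 H2. rewrite !E by auto. auto.
  - intros j Hj. rewrite E; auto.
  - intros i j v H1 H2. rewrite !E by auto. now apply Hd.
Qed.

(** * Advancing, touching and rotating the strands *)

Section Routing.

Variables (N : nat) (R : nat -> nat -> Prop).
Hypothesis G : jump_grid N R.

Let HN : 2 <= N := jg_N _ _ G.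
Let Hsym := jg_sym _ _ G.

Lemma power_pos n : 1 <= N ^ n.
Proof. apply (Nat.pow_le_mono_r N 0 n); lia. Qed.

Lemma power_succ n : N ^ (n + 1) = N * N ^ n.
Proof. rewrite Nat.add_1_r. reflexivity. Qed.

Lemma power_mono n m : n <= m -> N ^ n <= N ^ m.
Proof. intros. apply Nat.pow_le_mono_r; lia. Qed.

Lemma edge_line a n : 3 <= a -> R (N ^ n * a) (N ^ (n + 1) * a).
Proof.
  intros Ha. pose proof (power_pos n). rewrite power_succ.
  replace (N * N ^ n * a) with (N * (N ^ n * a) + 0) by lia.
  apply (jg_child _ _ G); nia.
Qed.

Lemma connected_pair a n : 3 <= a ->
  connected R (fun v => v = N ^ n * a \/ v = N ^ (n + 1) * a).
Proof.
  intros Ha. eapply connected_join; eauto using edge_line.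
  - intros x y -> ->. now apply conn_refl.
  - intros x y -> ->. now apply conn_refl.
Qed.

Lemma connected_point a : connected R (fun v => v = a).
Proof. intros x y -> ->. now apply conn_refl. Qed.

Lemma connected_interval a b : 3 <= a -> connected R (fun v => a <= v <= b).
Proof.
  intros Ha. induction b as [|b IH].
  - intros x y Hx Hy. lia.
  - destruct (le_lt_dec a b) as [L|L].
    + eapply connected_ext; [|apply (connected_join R (fun v => a <= v <= b)
        (fun v => v = S b) b (S b)); auto using connected_point].
      * intros v. simpl. split; lia.
      * right. rewrite <- Nat.add_1_r. apply (jg_succ _ _ G). lia.
    + intros x y Hx Hy. replace y with x by lia. apply conn_refl. auto.
Qed.

Lemma connected_line a lo hi : 3 <= a ->
  connected R (fun v => exists m, lo <= m <= hi /\ v = N ^ m * a).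
Proof.
  intros Ha. induction hi as [|h IH].
  - intros x y (m & Hm & ->) (m' & Hm' & ->).
    replace m' with m by lia. apply conn_refl. eauto.
  - destruct (le_lt_dec lo h) as [L|L].
    + eapply connected_ext; [|apply (connected_join R
        (fun v => exists m, lo <= m <= h /\ v = N ^ m * a)
        (fun v => v = N ^ (S h) * a) (N ^ h * a) (N ^ (S h) * a));
        auto using connected_point].
      * intros v. split.
        { intros [(m & Hm & ->)| ->]; [exists m|exists (S h)]; split; auto; lia. }
        intros (m & Hm & ->). destruct (Nat.eq_dec m (S h)) as [->|]; auto.
        left. exists m. split; auto. lia.
      * exists h. split; auto; lia.
      * right. rewrite <- Nat.add_1_r. now apply edge_line.
    + intros x y (m & Hm & ->) (m' & Hm' & ->).
      replace m' with m by lia. apply conn_refl. eauto.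
Qed.

Lemma turn_unique g n n' v :
  N ^ n * g <= v < N ^ (n + 1) * g -> N ^ n' * g <= v < N ^ (n' + 1) * g -> n = n'.
Proof.
  intros H H'. destruct (Nat.lt_trichotomy n n') as [L|[L|L]]; auto; exfalso.
  - assert (N ^ (n + 1) <= N ^ n') by (apply power_mono; lia). nia.
  - assert (N ^ (n' + 1) <= N ^ n) by (apply power_mono; lia). nia.
Qed.

Lemma in_turn g k n j : k + 3 <= g -> j < k ->
  N ^ n * g <= N ^ n * (g + j) < N ^ (n + 1) * g.
Proof.
  intros Hg Hj. pose proof (power_pos n). rewrite power_succ.
  split; [apply Nat.mul_le_mono_l; lia|].
  replace (N * N ^ n * g) with (N ^ n * (N * g)) by lia.
  apply Nat.mul_lt_mono_pos_l; nia.
Qed.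

Lemma line_unique g k n n' j j' : k + 3 <= g -> j < k -> j' < k ->
  N ^ n * (g + j) = N ^ n' * (g + j') -> n = n' /\ j = j'.
Proof.
  intros Hg Hj Hj' E.
  assert (n = n').
  { apply (turn_unique g n n' (N ^ n * (g + j))).
    - now apply (in_turn g k).
    - rewrite E. now apply (in_turn g k). }
  subst n'. pose proof (power_pos n). split; auto.
  apply Nat.mul_cancel_l in E; lia.
Qed.

Lemma advance lb n g k sg B : config N R lb n g k sg B ->
  exists B', (forall i v, B i v -> B' i v) /\ config N R lb (n + 1) g k sg B'.
Proof.
  intros C. assert (Hg : k + 3 <= g) by apply C.
  pose proof (power_pos n) as HP.
  destruct (config_extend N R lb n g k sg B (n + 1) g sg (fun j => j)
    (fun j v => v = N ^ n * (g + j) \/ v = N ^ (n + 1) * (g + j))) as (B' & H1 & _ & H2);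
    auto; [rewrite power_succ; nia| | | |exists B'; auto].
  - intros j Hj. split; [apply connected_pair; lia|]. split; auto.
    rewrite power_succ. intros v [->| ->]; nia.
  - intros i j v Hi Hj [->| ->] [E|E];
      eapply line_unique in E; eauto; tauto.
  - intros j Hj. split; auto. intros v [->| ->]; auto.
    pose proof (in_turn g k n j Hg Hj). lia.
Qed.

Lemma advance_many d lb n g k sg B : config N R lb n g k sg B ->
  exists B', (forall i v, B i v -> B' i v) /\ config N R lb (n + d) g k sg B'.
Proof.
  intros C. induction d as [|d (B1 & H1 & C1)].
  - exists B. rewrite Nat.add_0_r. auto.
  - destruct (advance _ _ _ _ _ _ C1) as (B2 & H2 & C2).
    exists B2. replace (n + S d) with (n + d + 1) by lia. auto.
Qed.

(** Strand 0 sweeps along the spiral up to the vertex just before the line of strand 1, while all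
    strands advance along their lines. *)
Lemma touch_next lb n g k sg B : config N R lb n g k sg B -> 2 <= k ->
  exists B', (forall i v, B i v -> B' i v) /\ config N R lb (n + 1) g k sg B' /\
    exists u v, B' (sg 0) u /\ B' (sg 1) v /\ R u v.
Proof.
  intros C Hk. assert (Hg : k + 3 <= g) by apply C.
  pose proof (power_pos n) as HP.
  set (D := fun j v => j = 0 /\ N ^ n * g <= v <= N ^ n * (g + 1) - 1 \/
                       j <> 0 /\ v = N ^ n * (g + j) \/ v = N ^ (n + 1) * (g + j)).
  assert (low : forall j v, j < k -> D j v ->
     N ^ n * (g + j) <= v < N ^ n * (g + j + 1) \/ v = N ^ (n + 1) * (g + j)).
  { intros j v Hj [[-> H]|[[Hj0 ->]| ->]]; auto; left; [|nia].
    rewrite !Nat.add_0_r. nia. }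
  destruct (config_extend N R lb n g k sg B (n + 1) g sg (fun j => j) D)
    as (B' & H1 & H1' & H2); auto; [rewrite power_succ; nia| | | |].
  - intros j Hj. split; [|split].
    + destruct (Nat.eq_dec j 0) as [->|Hj0].
      * eapply connected_ext; [|apply (connected_join R
          (fun v => N ^ n * g <= v <= N ^ n * (g + 1) - 1)
          (fun v => v = N ^ (n + 1) * g) (N ^ n * g) (N ^ (n + 1) * g));
          auto using connected_point].
        { intros v. unfold D. rewrite Nat.add_0_r. split; lia. }
        { apply connected_interval. nia. }
        { simpl. nia. }
        { right. apply edge_line. lia. }
      * eapply connected_ext; [|apply (connected_pair (g + j) n); lia].
        intros v. unfold D. tauto.
    + unfold D. destruct (Nat.eq_dec j 0) as [->|Hj0]; auto.
      left. split; auto. rewrite Nat.add_0_r. nia.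
    + intros v Hv. apply low in Hv; auto. rewrite power_succ in Hv. nia.
  - intros i j v Hi Hj Hvi Hvj. apply low in Hvi, Hvj; auto.
    pose proof (in_turn g k n i Hg Hi). pose proof (in_turn g k n j Hg Hj).
    rewrite power_succ in *.
    assert (forall j, j < k -> N ^ n * (g + j + 1) <= N * N ^ n * g).
    { intros l Hl. replace (N * N ^ n * g) with (N ^ n * (N * g)) by lia.
      apply Nat.mul_le_mono_l. nia. }
    pose proof (H1 i Hi). pose proof (H1 j Hj).
    destruct Hvi as [Hvi|Hvi], Hvj as [Hvj|Hvj]; nia.
  - intros j Hj. split; [unfold D; auto|]. intros v Hv Hle. apply low in Hv; auto.
    destruct Hv as [Hv|Hv]; auto. exfalso.
    rewrite power_succ in Hle.
    assert (N ^ n * (g + j + 1) <= N ^ n * (N * g)) by (apply Nat.mul_le_mono_l; nia).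
    nia.
  - exists B'. split; [auto|]. split; [auto|].
    exists (N ^ n * (g + 1) - 1), (N ^ n * (g + 1)). split; [|split].
    + apply H1'; [lia|]. left. split; auto. nia.
    + apply H1'; [lia|]. right; left. auto.
    + replace (N ^ n * (g + 1)) with (N ^ n * (g + 1) - 1 + 1) at 2 by nia.
      apply (jg_succ _ _ G). nia.
Qed.

(* Strand 0 travels along the turn behind all the others. *)
Lemma rotate lb n g k sg B : config N R lb n g k sg B -> 1 <= k ->
  exists B', (forall i v, B i v -> B' i v) /\
    config N R lb (n + 1) (g + 1) k (fun j => sg ((j + 1) mod k)) B'.
Proof.
  intros C Hk. assert (Hg : k + 3 <= g) by apply C.
  pose proof (power_pos n) as HP.
  assert (HX : N ^ n * (g + k) < N ^ n * (N * g)) by (apply Nat.mul_lt_mono_pos_l; nia).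
  (* Strand 0 goes out to [N ^ (n + 1) * g], back along turn [n] to the free line of [g + k], and
     out on it. For base [g + 1] this line is the last slot, and every other strand moves down one
     slot. *)
  set (D := fun j v => v = N ^ n * (g + j) \/
     j = 0 /\ (N ^ n * (g + k) <= v <= N ^ (n + 1) * g \/ v = N ^ (n + 1) * (g + k)) \/
     j <> 0 /\ v = N ^ (n + 1) * (g + j)).
  assert (Hmod : forall j, j < k -> (j + 1 < k /\ (j + 1) mod k = j + 1) \/
                                    (j + 1 = k /\ (j + 1) mod k = 0)).
  { intros j Hj. destruct (Nat.eq_dec (j + 1) k) as [E|E].
    - right. split; auto. rewrite E. apply Nat.Div0.mod_same.
    - left. split; [lia|]. apply Nat.mod_small. lia. }
  assert (cmp : forall i j, i < j -> N ^ n * (g + i) < N ^ n * (g + j))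
    by (intros; apply Nat.mul_lt_mono_pos_l; lia).
  assert (cmp' : forall i j, i < j -> N * N ^ n * (g + i) < N * N ^ n * (g + j))
    by (intros; apply Nat.mul_lt_mono_pos_l; nia).
  destruct (config_extend N R lb n g k sg B (n + 1) (g + 1)
    (fun j => sg ((j + 1) mod k)) (fun j => (j + 1) mod k) D)
    as (B' & H1 & _ & H2); auto; [lia|rewrite power_succ; nia| | | | | |exists B'; auto].
  - intros j Hj. destruct (Hmod j Hj) as [[? ->]|[? ->]]; split; auto; lia.
  - intros i j Hi Hj E. destruct (Hmod i Hi) as [[? E1]|[? E1]],
      (Hmod j Hj) as [[? E2]|[? E2]]; lia.
  - intros j Hj. split; [|split].
    + destruct (Nat.eq_dec j 0) as [->|Hj0].
      * assert (C1 : connected R (fun v => v = N ^ n * (g + k) \/ v = N ^ (n + 1) * (g + k)))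
          by (apply connected_pair; lia).
        assert (C2 : connected R (fun v => v = N ^ n * g \/ v = N ^ (n + 1) * g))
          by (apply connected_pair; lia).
        assert (C3 : connected R (fun v => N ^ n * (g + k) <= v <= N ^ (n + 1) * g))
          by (apply connected_interval; nia).
        assert (C4 := connected_join R _ _ (N ^ (n + 1) * g) (N ^ (n + 1) * g) Hsym C2 C3
          (or_intror eq_refl) ltac:(cbv beta; rewrite power_succ; lia) (or_introl eq_refl)).
        assert (C5 := connected_join R _ _ (N ^ n * (g + k)) (N ^ n * (g + k)) Hsym C4 C1
          ltac:(right; rewrite power_succ; lia) (or_introl eq_refl) (or_introl eq_refl)).
        eapply connected_ext; [|exact C5]. intros v. unfold D.
        rewrite power_succ, Nat.add_0_r. split; lia.
      * eapply connected_ext; [|apply (connected_pair (g + j) n); lia].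
        intros v. unfold D. tauto.
    + left; auto.
    + unfold D. rewrite power_succ. intros v Hv. nia.
  - intros i j v Hi Hj Hvi Hvj. unfold D in Hvi, Hvj. rewrite power_succ in Hvi, Hvj.
    pose proof (cmp' 0 k ltac:(lia)). pose proof (cmp 0 k ltac:(lia)).
    assert (K1 := fun i => cmp i k). assert (K2 := fun i => cmp' i k).
    assert (K3 := cmp' 0).
    rewrite Nat.add_0_r in *.
    pose proof (K1 i Hi). pose proof (K1 j Hj). pose proof (K2 i Hi). pose proof (K2 j Hj).
    pose proof (K3 i). pose proof (K3 j).
    destruct (Nat.lt_trichotomy i j) as [L|[L|L]]; auto; exfalso;
      pose proof (cmp _ _ L); pose proof (cmp' _ _ L); lia.
  - intros j Hj. unfold D. rewrite power_succ.
    destruct (Hmod j Hj) as [[? ->]|[? ->]].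
    + split; [right; right; split; [lia|]; f_equal; lia|].
      intros v Hv Hle.
      assert (N ^ n * (g + (j + 1)) < N * N ^ n * (g + 1)) by nia.
      replace (g + 1 + j) with (g + (j + 1)) by lia. lia.
    + split; [right; left; split; auto; right; f_equal; lia|].
      intros v Hv Hle. replace (g + 1 + j) with (g + k) by lia. nia.
Qed.

Lemma rotate_many m lb n g k sg B : config N R lb n g k sg B -> 1 <= k ->
  exists B', (forall i v, B i v -> B' i v) /\
    config N R lb (n + m) (g + m) k (fun j => sg ((j + m) mod k)) B'.
Proof.
  intros C Hk. induction m as [|m (B1 & H1 & C1)].
  - exists B. split; auto. rewrite !Nat.add_0_r. eapply config_same_strands; [|exact C].
    intros j Hj. simpl. now rewrite Nat.add_0_r, Nat.mod_small.
  - destruct (rotate _ _ _ _ _ _ C1 Hk) as (B2 & H2 & C2). exists B2. split; auto.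
    replace (n + S m) with (n + m + 1) by lia.
    replace (g + S m) with (g + m + 1) by lia.
    eapply config_same_strands; [|exact C2]. intros j Hj. simpl. f_equal.
    rewrite Nat.Div0.add_mod_idemp_l. f_equal. lia.
Qed.

(** [k * d] rotations restore all slots and only shift the base; this is how the bunch is moved away
    from given vertices. *)
Lemma rotate_full d lb n g k sg B : config N R lb n g k sg B -> 1 <= k ->
  exists B', (forall i v, B i v -> B' i v) /\
    config N R lb (n + k * d) (g + k * d) k sg B'.
Proof.
  intros C Hk. destruct (rotate_many (k * d) _ _ _ _ _ _ C Hk) as (B' & H & C').
  exists B'. split; auto. eapply config_same_strands; [|exact C'].
  intros j Hj. simpl. f_equal. rewrite Nat.mul_comm, Nat.Div0.mod_add.
  now rewrite Nat.mod_small.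
Qed.

End Routing.

(** * Crossing the first and the last strand at a jump *)

Section Swap.

Variables (N : nat) (R : nat -> nat -> Prop).
Hypothesis G : jump_grid N R.

Let HN : 2 <= N := jg_N _ _ G.
Let Hsym := jg_sym _ _ G.

Definition exchange (k j : nat) : nat :=
  if Nat.eq_dec j 0 then k - 1 else if Nat.eq_dec j (k - 1) then 0 else j.

(** Strands [k - 1] (on [DA]) and 0 (on [DB]) are neighbours across the sector from the line of
    [g + (k - 1)] to the line of [g] one turn later. The other strands never enter this sector and
    go straight on. *)
Lemma swap_extend lb n g k sg B t (DA DB : nat -> Prop) :
  config N R lb n g k sg B -> 2 <= k -> n < t ->
  connected R DA -> connected R DB ->
  DA (N ^ n * (g + (k - 1))) -> DA (N ^ t * g) ->
  DB (N ^ n * g) -> DB (N ^ t * (g + (k - 1))) ->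
  (forall v, DA v -> DB v -> False) ->
  (forall v, DA v -> N ^ n * g <= v /\ (N ^ t * g <= v -> v = N ^ t * g)) ->
  (forall v, DB v -> N ^ n * g <= v /\ (N ^ t * g <= v -> v = N ^ t * (g + (k - 1)))) ->
  (forall v, DA v \/ DB v ->
     exists m, v = N ^ m * g \/ N ^ m * (g + (k - 1)) <= v < N ^ (m + 1) * g) ->
  exists B', (forall i v, B i v -> B' i v) /\
    config N R lb t g k (fun j => sg (exchange k j)) B'.
Proof.
  intros C Hk Hnt CA CB A1 A2 B1 B2 HAB HA HB Hsec.
  assert (Hg : k + 3 <= g) by apply C.
  set (D := fun j v => (j = 0 /\ DB v) \/ (j = k - 1 /\ DA v) \/
    (0 < j < k - 1 /\ exists m, n <= m <= t /\ v = N ^ m * (g + j))).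
  assert (off : forall j v, 0 < j < k - 1 -> DA v \/ DB v ->
                forall m, v <> N ^ m * (g + j)).
  { intros j v Hj Hv m ->. destruct (Hsec _ Hv) as [m' [E|E]].
    - replace g with (g + 0) in E at 2 by lia.
      apply (line_unique N R G g k) in E; lia.
    - pose proof (in_turn N R G g k m j Hg ltac:(lia)) as T1.
      pose proof (power_pos N R G m).
      assert (m = m').
      { apply (turn_unique N R G g _ _ _ T1). nia. }
      subst m'. nia. }
  assert (Hcase : forall j, j < k -> j = 0 \/ j = k - 1 \/ 0 < j < k - 1) by lia.
  assert (Hex : forall j, j < k -> j = 0 /\ exchange k j = k - 1 \/
      j = k - 1 /\ exchange k j = 0 \/ 0 < j < k - 1 /\ exchange k j = j).
  { intros j Hj. unfold exchange.
    destruct (Nat.eq_dec j 0), (Nat.eq_dec j (k - 1)); lia. }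
  destruct (config_extend N R lb n g k sg B t g (fun j => sg (exchange k j)) (exchange k) D)
    as (B' & H1 & _ & H2); auto; [| | | | | |exists B'; auto].
  - apply Nat.mul_le_mono_r. apply (power_mono N R G). lia.
  - intros j Hj. split; auto. destruct (Hex j Hj) as [[? ->]|[[? ->]|[? ->]]]; lia.
  - intros i j Hi Hj E. destruct (Hex i Hi) as [[? E1]|[[? E1]|[? E1]]],
      (Hex j Hj) as [[? E2]|[[? E2]|[? E2]]]; lia.
  - intros j Hj. destruct (Hcase j Hj) as [->|[->|Hj']].
    + rewrite Nat.add_0_r. split; [|split].
      * eapply connected_ext; [|exact CB]. unfold D. split; [auto|].
        intros [[_ ?]|[[? _]|[? _]]]; auto; lia.
      * left; auto.
      * intros v [[_ H]|[[? _]|[? _]]]; try lia. now apply HB.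
    + split; [|split].
      * eapply connected_ext; [|exact CA]. unfold D. split; [auto|].
        intros [[? _]|[[_ ?]|[? _]]]; auto; lia.
      * right; left; auto.
      * intros v [[? _]|[[_ H]|[? _]]]; try lia. now apply HA.
    + split; [|split].
      * eapply connected_ext; [|apply (connected_line N R G (g + j) n t); lia].
        unfold D. split; [auto|].
        intros [[? _]|[[? _]|[_ ?]]]; auto; lia.
      * right; right. split; auto. exists n. split; auto; lia.
      * intros v [[? _]|[[? _]|(_ & m & Hm & ->)]]; try lia.
        apply Nat.mul_le_mono; [|lia]. apply (power_mono N R G); lia.
  - intros i j v Hi Hj [[Ei Hvi]|[[Ei Hvi]|(Ei & m & Hm & Hvi)]]
      [[Ej Hvj]|[[Ej Hvj]|(Ej & m' & Hm' & Hvj)]]; subst; auto.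
    all: try (exfalso; now eapply HAB; eauto).
    all: try (exfalso; now eapply (off j (N ^ m' * (g + j))); eauto).
    all: try (exfalso; now eapply (off i (N ^ m * (g + i))); eauto).
    apply (line_unique N R G g k) in Hvj; lia.
  - intros j Hj. destruct (Hex j Hj) as [[-> ->]|[[-> ->]|[Hj' ->]]].
    + rewrite Nat.add_0_r. split; [right; left; auto|].
      intros v [[? _]|[[_ H]|[? _]]]; try lia. now apply HA.
    + split; [left; auto|].
      intros v [[_ H]|[[? _]|[? _]]]; try lia. now apply HB.
    + split; [right; right; split; auto; exists t; split; auto; lia|].
      intros v [[? _]|[[? _]|(_ & m & Hm & ->)]] Hle; try lia.
      destruct (Nat.eq_dec m t) as [->|]; auto. exfalso.
      pose proof (in_turn N R G g k m j Hg Hj).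
      assert (N ^ (m + 1) <= N ^ t) by (apply (power_mono N R G); lia). nia.
Qed.

(* The two strands cross inside the free sector between the last strand [A] and
   the first strand [B]: [A] follows its line up to turn [n], the spiral to
   [x1], the edge to [z1] and the spiral to the line of [B]; [B] goes back along
   turn [n] to [x2], takes the edge to [z2] and goes back to the line of [A]. *)
Lemma swap_cross lb n g k sg B c x1 z1 x2 z2 :
  config N R lb n g k sg B -> 2 <= k -> n < c ->
  R x1 z1 -> R x2 z2 ->
  N ^ n * (g + (k - 1)) <= x1 -> x1 < x2 -> x2 <= N ^ (n + 1) * g ->
  N ^ (n + 1) * (g + (k - 1)) <= z2 -> z2 <= N ^ (n + 2) * g -> z2 < z1 ->
  N ^ c * (g + (k - 1)) < z1 -> z1 <= N ^ (c + 1) * g ->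
  exists B', (forall i v, B i v -> B' i v) /\
    config N R lb (c + 1) g k (fun j => sg (exchange k j)) B'.
Proof.
  intros C Hk Hnc E1 E2 Hx1 Hx Hx2 Hz2 Hz2' Hz Hz1 Hz1'.
  assert (Hg : k + 3 <= g) by apply C.
  set (h := g + (k - 1)) in *.
  assert (F : forall m, N ^ m * g < N ^ m * h < N ^ (m + 1) * g).
  { intros m. pose proof (power_pos N R G m).
    pose proof (in_turn N R G g k m (k - 1) Hg ltac:(lia)). unfold h. nia. }
  assert (Hh : 3 <= h) by (unfold h; lia).
  assert (Hx1' : 3 <= x1) by (pose proof (power_pos N R G n); nia).
  assert (Mg : forall m m', m <= m' -> N ^ m * g <= N ^ m' * g)
    by (intros; apply Nat.mul_le_mono_r, (power_mono N R G); auto).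
  assert (Mh : forall m m', m <= m' -> N ^ m * h <= N ^ m' * h)
    by (intros; apply Nat.mul_le_mono_r, (power_mono N R G); auto).
  assert (Lo : 3 <= N ^ n * g) by (pose proof (power_pos N R G n); nia).
  assert (F0 := F n). assert (F1 := F (n + 1)). assert (Fc := F c).
  replace (n + 1 + 1) with (n + 2) in F1 by lia.
  assert (M1 := Mg (n + 1) c ltac:(lia)). assert (M2 := Mh (n + 1) c ltac:(lia)).
  apply (swap_extend lb n g k sg B (c + 1)
    (fun v => N ^ n * h <= v <= x1 \/ z1 <= v <= N ^ (c + 1) * g)
    (fun v => (((v = N ^ n * g \/ v = N ^ (n + 1) * g) \/ x2 <= v <= N ^ (n + 1) * g) \/
      N ^ (n + 1) * h <= v <= z2) \/
      exists m, n + 1 <= m <= c + 1 /\ v = N ^ m * h)); auto; try lia.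
  - apply (connected_join R _ _ x1 z1); auto; try lia;
      apply (connected_interval N R G); lia.
  - apply (connected_join R _ _ (N ^ (n + 1) * h) (N ^ (n + 1) * h)); auto.
    + apply (connected_join R _ _ x2 z2); auto; try lia.
      * apply (connected_join R _ _ (N ^ (n + 1) * g) (N ^ (n + 1) * g)); auto; try lia.
        -- apply (connected_pair N R G). lia.
        -- apply (connected_interval N R G). lia.
      * apply (connected_interval N R G). lia.
    + apply (connected_line N R G). lia.
    + exists (n + 1). split; auto; lia.
  - right. exists (c + 1). split; auto; lia.
  - intros v HA [HB|(m & Hm & ->)]; [lia|].
    destruct HA as [HA|HA].
    + specialize (Mh (n + 1) m ltac:(lia)). lia.
    + destruct (Nat.eq_dec m (c + 1)) as [->|].
      * specialize (F (c + 1)). lia.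
      * specialize (Mh m c ltac:(lia)). lia.
  - intros v [HB|(m & Hm & ->)].
    + split; [lia|]. intros Hle. exfalso. lia.
    + split; [specialize (Mh (n + 1) m ltac:(lia)); lia|].
      destruct (Nat.eq_dec m (c + 1)) as [->|]; auto. intros Hle. exfalso.
      specialize (Mh m c ltac:(lia)). lia.
  - assert (P : forall m v, N ^ m * h <= v <= N ^ (m + 1) * g ->
      exists m, v = N ^ m * g \/ N ^ m * h <= v < N ^ (m + 1) * g).
    { intros m v Hv. destruct (Nat.eq_dec v (N ^ (m + 1) * g)) as [->|]; eauto.
      exists m. right. lia. }
    intros v [[HA|HA]|[[[[HB|HB]|HB]|HB]|(m & Hm & ->)]].
    + apply (P n). lia.
    + apply (P c). lia.
    + eauto.
    + eauto.
    + apply (P n). lia.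
    + apply (P (n + 1)). replace (n + 1 + 1) with (n + 2) by lia. lia.
    + apply (P m). specialize (F m). lia.
Qed.

(* Here the jump [x z] stays in one turn; [B] passes it through [x + 1]. *)
Lemma swap_under lb n g k sg B x z :
  config N R lb n g k sg B -> 2 <= k ->
  R x z -> x + 2 <= z ->
  N ^ (n + 1) * (g + k) < x -> z <= N ^ (n + 2) * g ->
  exists B', (forall i v, B i v -> B' i v) /\
    config N R lb (n + 3) g k (fun j => sg (exchange k j)) B'.
Proof.
  intros C Hk Exz Hxz Hx Hz.
  assert (Hg : k + 3 <= g) by apply C.
  set (h := g + (k - 1)) in *.
  assert (F : forall m, N ^ m * g < N ^ m * h < N ^ (m + 1) * g).
  { intros m. pose proof (power_pos N R G m).
    pose proof (in_turn N R G g k m (k - 1) Hg ltac:(lia)). unfold h. nia. }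
  assert (Hh : 3 <= h) by (unfold h; lia).
  assert (Lo : 3 <= N ^ n * g) by (pose proof (power_pos N R G n); nia).
  assert (F0 := F n). assert (F1 := F (n + 1)). assert (F2 := F (n + 2)).
  assert (F3 := F (n + 3)).
  replace (n + 1 + 1) with (n + 2) in F1 by lia.
  replace (n + 2 + 1) with (n + 3) in F2 by lia.
  assert (S1 : N ^ (n + 1) * (g + k) = N * (N ^ n * (g + k)))
    by (rewrite power_succ; lia).
  assert (S1g : N ^ (n + 1) * g = N * (N ^ n * g)) by (rewrite power_succ; lia).
  assert (S2g : N ^ (n + 2) * g = N * (N ^ (n + 1) * g))
    by (replace (n + 2) with (n + 1 + 1) by lia; rewrite (power_succ N (n + 1)); lia).
  assert (S2h : N ^ (n + 2) * h = N * (N ^ (n + 1) * h))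
    by (replace (n + 2) with (n + 1 + 1) by lia; rewrite (power_succ N (n + 1)); lia).
  assert (S3g : N ^ (n + 3) * g = N * (N ^ (n + 2) * g))
    by (replace (n + 3) with (n + 2 + 1) by lia; rewrite (power_succ N (n + 2)); lia).
  pose proof (power_pos N R G n) as HP.
  assert (Hhk : N ^ n * h < N ^ n * (g + k)) by (apply Nat.mul_lt_mono_pos_l; unfold h; lia).
  assert (Hhk' : N ^ (n + 1) * h < N ^ (n + 1) * (g + k))
    by (apply Nat.mul_lt_mono_pos_l; [pose proof (power_pos N R G (n + 1))|unfold h]; lia).
  (* [B] reaches [y] from its parent [q] and leaves by its first child, while [A] jumps over [y];
     this needs [x + 2 <= z]. The bound on [x] by [g + k] instead of [g + (k - 1)] keeps [q] off the
     line of [A]. *)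
  set (y := x + 1). set (q := y / N).
  pose proof (Nat.div_mod_eq y N) as Ey. fold q in Ey.
  pose proof (Nat.mod_upper_bound y N ltac:(lia)) as Hmod.
  assert (Hq1 : N ^ n * (g + k) <= q).
  { apply Nat.div_le_lower_bound; unfold y; lia. }
  assert (Hq2 : q < N ^ (n + 1) * g).
  { apply Nat.Div0.div_lt_upper_bound. unfold y. lia. }
  assert (Hq3 : 3 <= q) by (clear - Lo F0 Hhk Hq1; lia).
  assert (Eq : R q y) by (rewrite Ey; apply (jg_child _ _ G); auto).
  assert (Hy3 : 3 <= y) by (unfold y; lia).
  assert (Ey' : R y (N * y)).
  { rewrite <- (Nat.add_0_r (N * y)). apply (jg_child _ _ G); lia. }
  assert (HNy : N ^ (n + 2) * h <= N * y) by (rewrite S2h; apply Nat.mul_le_mono_l; unfold y; lia).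
  assert (HNy' : N * y < N ^ (n + 3) * g)
    by (rewrite S3g; apply Nat.mul_lt_mono_pos_l; unfold y; lia).
  apply (swap_extend lb n g k sg B (n + 3)
    (fun v => ((v = N ^ n * h \/ N ^ (n + 1) * h <= v <= x) \/ z <= v <= N ^ (n + 2) * g) \/
              v = N ^ (n + 3) * g)
    (fun v => ((((v = N ^ n * g \/ q <= v <= N ^ (n + 1) * g) \/ v = y) \/
      N ^ (n + 2) * h <= v <= N * y) \/ v = N ^ (n + 3) * h))); auto; try lia.
  - apply (connected_join R _ _ (N ^ (n + 2) * g) (N ^ (n + 3) * g)); auto.
    + apply (connected_join R _ _ x z); auto; try lia.
      * apply (connected_join R _ _ (N ^ n * h) (N ^ (n + 1) * h)); auto; try lia.
        -- apply connected_point.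
        -- apply (connected_interval N R G). lia.
        -- right. apply (edge_line N R G). lia.
      * apply (connected_interval N R G). lia.
    + apply connected_point.
    + right. replace (n + 3) with (n + 2 + 1) by lia. apply (edge_line N R G). lia.
  - apply (connected_join R _ _ (N ^ (n + 2) * h) (N ^ (n + 3) * h)); auto.
    + apply (connected_join R _ _ y (N * y)); auto; try lia.
      * apply (connected_join R _ _ q y); auto; try lia.
        -- apply (connected_join R _ _ (N ^ n * g) (N ^ (n + 1) * g)); auto; try lia.
           ++ apply connected_point.
           ++ apply (connected_interval N R G). lia.
           ++ right. apply (edge_line N R G). lia.
        -- apply connected_point.
      * apply (connected_interval N R G). lia.
    + apply connected_point.
    + right. replace (n + 3) with (n + 2 + 1) by lia. apply (edge_line N R G). lia.
  - assert (P : forall m v, N ^ m * h <= v <= N ^ (m + 1) * g ->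
      exists m, v = N ^ m * g \/ N ^ m * h <= v < N ^ (m + 1) * g).
    { intros m v Hv. destruct (Nat.eq_dec v (N ^ (m + 1) * g)) as [->|]; eauto.
      exists m. right. lia. }
    intros v [[[[HA|HA]|HA]|HA]|[[[[HB|HB]|HB]|HB]|HB]].
    + apply (P n). lia.
    + apply (P (n + 1)). replace (n + 1 + 1) with (n + 2) by lia. lia.
    + apply (P (n + 1)). replace (n + 1 + 1) with (n + 2) by lia. lia.
    + eauto.
    + eauto.
    + apply (P n). lia.
    + apply (P (n + 1)). replace (n + 1 + 1) with (n + 2) by lia. unfold y in HB. lia.
    + apply (P (n + 2)). replace (n + 2 + 1) with (n + 3) by lia. lia.
    + apply (P (n + 3)). lia.
Qed.

End Swap.

(** * Making any two strands touch *)

Definition same_strands (k : nat) (sg sg' : nat -> nat) : Prop :=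
  forall i, (exists j, j < k /\ sg j = i) <-> (exists j, j < k /\ sg' j = i).

Lemma same_strands_trans k sg1 sg2 sg3 :
  same_strands k sg1 sg2 -> same_strands k sg2 sg3 -> same_strands k sg1 sg3.
Proof. intros H1 H2 i. rewrite (H1 i). apply H2. Qed.

Section Touch.

Variables (N : nat) (R : nat -> nat -> Prop).
Hypothesis G : jump_grid N R.

Let HN : 2 <= N := jg_N _ _ G.

(** The lines of the bunch with one spare line on each side, in all turns; the spare lines leave
    room in the free sector for the neighbours [x - 1] and [x + 1] of an end of a jump. *)
Definition strand_zone (k g v : nat) : Prop :=
  exists m, N ^ m * (g - 1) <= v <= N ^ m * (g + k).

Lemma strand_zone_disjoint k g g' v :
  strand_zone k g v -> strand_zone k g' v ->
  1 <= g -> g + k < g' - 1 -> g' + k < N * (g - 1) -> False.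
Proof.
  intros (m & Hm) (m' & Hm') Hg Hgg Hn.
  pose proof (power_pos N R G m). pose proof (power_pos N R G m').
  assert (N ^ m * (g + k) < N ^ m * (N * (g - 1))) by (apply Nat.mul_lt_mono_pos_l; lia).
  assert (N ^ m' * (g' + k) < N ^ m' * (N * (g - 1))) by (apply Nat.mul_lt_mono_pos_l; lia).
  assert (N ^ m' * (g - 1) <= N ^ m' * (g' - 1)) by (apply Nat.mul_le_mono_l; lia).
  assert (m = m').
  { apply (turn_unique N R G (g - 1) m m' v); rewrite power_succ; lia. }
  subst m'.
  assert (N ^ m * (g + k) < N ^ m * (g' - 1)) by (apply Nat.mul_lt_mono_pos_l; lia).
  lia.
Qed.

Lemma outside_zone k g v : 2 <= g -> g <= v -> ~ strand_zone k g v ->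
  exists c, N ^ c * (g + k) < v < N ^ (c + 1) * (g - 1).
Proof.
  intros Hg Hv Hz.
  destruct (least_nat (fun m => v < N ^ m * (g - 1)) v) as (m & Hm & Hmin).
  { pose proof (Nat.pow_gt_lin_r N v ltac:(lia)). nia. }
  destruct m as [|c]; [simpl in Hm; lia|].
  specialize (Hmin c ltac:(lia)). exists c. rewrite Nat.add_1_r. split; auto.
  apply Nat.nle_gt. intros Hle. apply Hz. exists c. lia.
Qed.

(* The three zones are disjoint, so [x] and [z] together miss one of them. *)
Lemma free_base k g x z : 1 <= k -> 7 * k + 3 <= g ->
  exists i, i <= 2 /\ ~ strand_zone k (g + k * (3 * i)) x /\
                      ~ strand_zone k (g + k * (3 * i)) z.
Proof.
  intros Hk Hg.
  assert (D : forall v i i', i < i' -> i' <= 2 ->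
    strand_zone k (g + k * (3 * i)) v -> strand_zone k (g + k * (3 * i')) v -> False).
  (* [7 * k + 3 <= g] keeps the third zone, of base [g + 6 * k], from reaching the first zone one
     turn later: [g + 7 * k < 2 * (g - 1)]. *)
  { intros v i i' Hi Hi' H H'. apply (strand_zone_disjoint k _ _ v H H'); nia. }
  assert (D01 := fun v => D v 0 1 ltac:(lia) ltac:(lia)).
  assert (D02 := fun v => D v 0 2 ltac:(lia) ltac:(lia)).
  assert (D12 := fun v => D v 1 2 ltac:(lia) ltac:(lia)).
  clear D.
  assert (x01 := D01 x). assert (x02 := D02 x). assert (x12 := D12 x).
  assert (z01 := D01 z). assert (z02 := D02 z). assert (z12 := D12 z).
  destruct (classic (strand_zone k (g + k * (3 * 0)) x \/ strand_zone k (g + k * (3 * 0)) z)).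
  - destruct (classic (strand_zone k (g + k * (3 * 1)) x \/
                       strand_zone k (g + k * (3 * 1)) z)).
    + exists 2. split; [lia|]. tauto.
    + exists 1. split; [lia|]. tauto.
  - exists 0. split; [lia|]. tauto.
Qed.

(** Unless [x] and [z] lie in one turn, the jump is paired with an edge at [x - 1] or [x + 1] so
    that [x1 < x2] and [z2 < z1], as [swap_cross] asks. [A] takes the jump if [z] lies beyond the
    children of [x], and [B] takes it if [z] lies before them. *)
Lemma swap_at lb n g k sg B x z c c' :
  config N R lb n g k sg B -> 2 <= k -> n + 2 <= c ->
  x + 2 <= z -> R x z ->
  (z + 1 < N * x \/ (z + 1 = N * x /\ R (x - 1) (N * x)) \/
     (z = N * x + N /\ R (x + 1) (N * x + N - 1)) \/ N * x + N < z) ->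
  N ^ c * (g + k) < x < N ^ (c + 1) * (g - 1) ->
  N ^ c' * (g + k) < z < N ^ (c' + 1) * (g - 1) ->
  exists n' B', (forall i v, B i v -> B' i v) /\
    config N R lb n' g k (fun j => sg (exchange k j)) B'.
Proof.
  intros C Hk Hnc Hxz Exz Hcase Hx Hz.
  assert (Hg : k + 3 <= g) by apply C.
  pose proof (power_pos N R G c) as HP.
  assert (W : forall m, N ^ m * (g + (k - 1)) < N ^ m * (g + k) /\
                        N ^ m * (g - 1) <= N ^ m * g).
  { intros m. pose proof (power_pos N R G m).
    split; [apply Nat.mul_lt_mono_pos_l|apply Nat.mul_le_mono_l]; lia. }
  assert (Wc := W c). assert (Wc1 := W (c + 1)). assert (Wd := W c').
  assert (Wd1 := W (c' + 1)).
  assert (S1 : N ^ (c + 1) * (g + (k - 1)) = N * (N ^ c * (g + (k - 1))))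
    by (rewrite power_succ; lia).
  assert (S1k : N ^ (c + 1) * (g + k) = N * (N ^ c * (g + k)))
    by (rewrite power_succ; lia).
  assert (S2 : N ^ (c + 2) * g = N * (N ^ (c + 1) * g))
    by (replace (c + 2) with (c + 1 + 1) by lia; rewrite (power_succ N (c + 1)); lia).
  assert (Hx3 : 4 <= x) by nia.
  assert (Nx : N * (N ^ c * (g + k)) + N <= N * x)
    by (replace (N * (N ^ c * (g + k)) + N) with (N * (N ^ c * (g + k) + 1)) by lia;
        apply Nat.mul_le_mono_l; lia).
  assert (Nx' : N * x + N <= N * (N ^ (c + 1) * g))
    by (replace (N * x + N) with (N * (x + 1)) by lia; apply Nat.mul_le_mono_l; lia).
  assert (Nh : N * (N ^ c * (g + (k - 1))) <= N * (N ^ c * (g + k)))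
    by (apply Nat.mul_le_mono_l; lia).
  assert (Hs1 : R x (x + 1)) by (apply (jg_succ _ _ G); lia).
  assert (Hlast : R (x - 1) (N * x - 1)).
  { replace (N * x - 1) with (N * (x - 1) + (N - 1)) by nia.
    apply (jg_child _ _ G); lia. }
  assert (Hfirst : R (x + 1) (N * x + N)).
  { replace (N * x + N) with (N * (x + 1) + 0) by lia. apply (jg_child _ _ G); lia. }
  assert (turns : c < c' -> N ^ (c + 1) * (g + k) <= N ^ c' * (g + k)).
  { intros. apply Nat.mul_le_mono_r, (power_mono N R G). lia. }
  assert (turns' : c' < c -> N ^ (c' + 1) * g <= N ^ c * g).
  { intros. apply Nat.mul_le_mono_r, (power_mono N R G). lia. }
  assert (HPg : N ^ c * g <= N ^ c * (g + k)) by (apply Nat.mul_le_mono_l; lia).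
  assert (Hcc : c <= c') by (apply Nat.nlt_ge; intros ?; lia).
  destruct (advance_many N R G (c - 1 - n) _ _ _ _ _ _ C) as (B1 & H1 & C1).
  replace (n + (c - 1 - n)) with (c - 1) in C1 by lia.
  destruct (advance N R G _ _ _ _ _ _ C1) as (B2 & H2 & C2).
  replace (c - 1 + 1) with c in C2 by lia.
  assert (far : forall x1 z1 x2 z2 d, c < d ->
    R x1 z1 -> R x2 z2 ->
    N ^ c * (g + (k - 1)) <= x1 -> x1 < x2 -> x2 <= N ^ (c + 1) * g ->
    N ^ (c + 1) * (g + (k - 1)) <= z2 -> z2 <= N ^ (c + 2) * g -> z2 < z1 ->
    N ^ d * (g + (k - 1)) < z1 -> z1 <= N ^ (d + 1) * g ->
    exists n' B', (forall i v, B i v -> B' i v) /\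
      config N R lb n' g k (fun j => sg (exchange k j)) B').
  { intros x1 z1 x2 z2 d. intros.
    destruct (swap_cross N R G lb c g k sg B2 d x1 z1 x2 z2) as (B3 & HB3 & C3); auto.
    exists (d + 1), B3. auto. }
  destruct Hcase as [Hc|[[Hc Hc']|[[Hc Hc']|Hc]]].
  - destruct (Nat.eq_dec c c') as [<-|Hne].
    + destruct (swap_under N R G lb (c - 1) g k sg B1 x z) as (B3 & H3 & C3); auto.
      * replace (c - 1 + 1) with c by lia. lia.
      * replace (c - 1 + 2) with (c + 1) by lia. lia.
      * exists (c - 1 + 3), B3. auto.
    + specialize (turns ltac:(lia)).
      apply (far (x - 1) (N * x - 1) x z (c + 1)); auto; try lia.
      replace (c + 1 + 1) with (c + 2) by lia. lia.
  - apply (far (x - 1) (N * x) x z (c + 1)); auto; try lia.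
    replace (c + 1 + 1) with (c + 2) by lia. lia.
  - apply (far x z (x + 1) (N * x + N - 1) (c + 1)); auto; try lia.
    replace (c + 1 + 1) with (c + 2) by lia. lia.
  - assert (c <> c') by (intros <-; lia).
    apply (far x z (x + 1) (N * x + N) c'); auto; lia.
Qed.

Lemma swap_step lb n g k sg B : config N R lb n g k sg B -> 2 <= k ->
  exists n' g' B', (forall i v, B i v -> B' i v) /\
    config N R lb n' g' k (fun j => sg (exchange k j)) B'.
Proof.
  intros C Hk.
  (* This makes the base at least [7 * k + 3], as [free_base] requires. *)
  destruct (rotate_full N R G 7 _ _ _ _ _ _ C ltac:(lia)) as (B1 & H1 & C1).
  assert (Hg : k + 3 <= g) by apply C.
  set (n1 := n + k * 7) in *. set (g1 := g + k * 7) in *.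
  (* The base is chosen after the jump, so the jump is taken beyond what the farthest of the three
     candidates, [6 * k] rotations away, will need. *)
  destruct (jg_jump _ _ G (N ^ (n1 + k * 6 + 2) * (g1 + k * 6))) as (x & z & Hx & Hxz & Exz & Hcase).
  destruct (free_base k g1 x z) as (i & Hi & Zx & Zz); [lia|lia|].
  destruct (rotate_full N R G (3 * i) _ _ _ _ _ _ C1 ltac:(lia)) as (B2 & H2 & C2).
  set (n2 := n1 + k * (3 * i)) in *. set (g2 := g1 + k * (3 * i)) in *.
  assert (Hg2 : g2 <= g1 + k * 6) by (unfold g2; nia).
  assert (Hn2 : n2 <= n1 + k * 6) by (unfold n2; nia).
  assert (Hx2 : N ^ (n2 + 2) * g2 <= x).
  { eapply Nat.le_trans; [|exact Hx].
    apply Nat.mul_le_mono; auto. apply (power_mono N R G). lia. }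
  assert (1 * g2 <= N ^ (n2 + 2) * g2) by apply Nat.mul_le_mono_r, (power_pos N R G).
  assert (g2 <= x) by lia.
  assert (2 <= g2) by (unfold g2, g1; lia).
  destruct (outside_zone k g2 x) as (c & Hc); auto.
  destruct (outside_zone k g2 z) as (c' & Hc'); auto; [lia|].
  assert (Hnc : n2 + 2 <= c).
  { apply Nat.nlt_ge. intros L.
    assert (N ^ (c + 1) * (g2 - 1) <= N ^ (n2 + 2) * g2).
    { apply Nat.mul_le_mono; [apply (power_mono N R G)|]; lia. }
    lia. }
  destruct (swap_at lb n2 g2 k sg B2 x z c c') as (n' & B3 & HB3 & C3); auto.
  exists n', g2, B3. auto.
Qed.

Lemma rotate_same_strands k m sg : 1 <= k ->
  same_strands k sg (fun j => sg ((j + m) mod k)).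
Proof.
  intros Hk i. split; intros (j & Hj & E).
  - exists ((j + (k - m mod k)) mod k). split; [apply Nat.mod_upper_bound; lia|].
    rewrite <- E. f_equal. rewrite Nat.Div0.add_mod_idemp_l.
    pose proof (Nat.div_mod_eq m k). pose proof (Nat.mod_upper_bound m k ltac:(lia)).
    replace (j + (k - m mod k) + m) with (j + (m / k + 1) * k) by nia.
    rewrite Nat.Div0.mod_add. now apply Nat.mod_small.
  - exists ((j + m) mod k). split; auto. apply Nat.mod_upper_bound. lia.
Qed.

Lemma exchange_same_strands k sg : 1 <= k ->
  same_strands k sg (fun j => sg (exchange k j)).
Proof.
  intros Hk.
  assert (E : forall j, j < k -> exchange k j < k /\ exchange k (exchange k j) = j).
  { intros j Hj. unfold exchange.
    repeat (destruct Nat.eq_dec; try lia). }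
  intros i. split; intros (j & Hj & Ej); exists (exchange k j); split;
    try (apply E; auto); auto.
  now rewrite (proj2 (E j Hj)).
Qed.

(* Rotating strand 0 to the end and exchanging it with strand 1, now at the
   front, brings it one step closer to its target. *)
Lemma touch_zero d : forall lb n g k sg B,
  config N R lb n g k sg B -> d + 1 < k ->
  exists n' g' sg' B', (forall i v, B i v -> B' i v) /\ config N R lb n' g' k sg' B' /\
    same_strands k sg sg' /\
    exists u v, B' (sg 0) u /\ B' (sg (d + 1)) v /\ R u v.
Proof.
  induction d as [|d IH]; intros lb n g k sg B C Hd.
  - destruct (touch_next N R G _ _ _ _ _ _ C ltac:(lia)) as (B' & H & C' & HT).
    exists (n + 1), g, sg, B'. split; [auto|]. split; [auto|]. split; [now intros i|auto].
  - destruct (rotate N R G _ _ _ _ _ _ C ltac:(lia)) as (B1 & H1 & C1).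
    destruct (swap_step _ _ _ _ _ _ C1 ltac:(lia)) as (n2 & g2 & B2 & H2 & C2).
    destruct (IH _ _ _ _ _ _ C2 ltac:(lia)) as (n3 & g3 & sg3 & B3 & H3 & C3 & S3 & HT).
    exists n3, g3, sg3, B3. split; [auto|]. split; [auto|]. split.
    + eapply same_strands_trans; [apply (rotate_same_strands k 1); lia|].
      eapply same_strands_trans; [|exact S3].
      apply (exchange_same_strands k (fun j => sg ((j + 1) mod k))). lia.
    + assert (E0 : (exchange k 0 + 1) mod k = 0).
      { unfold exchange. destruct Nat.eq_dec; [|lia].
        replace (k - 1 + 1) with k by lia. apply Nat.Div0.mod_same. }
      assert (E1 : (exchange k (d + 1) + 1) mod k = S d + 1).
      { unfold exchange. destruct Nat.eq_dec; [lia|]. destruct Nat.eq_dec; [lia|].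
        rewrite Nat.mod_small; lia. }
      rewrite E0, E1 in HT. exact HT.
Qed.

Lemma touch_slots lb n g k sg B a b :
  config N R lb n g k sg B -> a < k -> b < k -> a <> b ->
  exists n' g' sg' B', (forall i v, B i v -> B' i v) /\ config N R lb n' g' k sg' B' /\
    same_strands k sg sg' /\
    exists u v, B' (sg a) u /\ B' (sg b) v /\ R u v.
Proof.
  intros C Ha Hb Hab.
  destruct (rotate_many N R G a _ _ _ _ _ _ C ltac:(lia)) as (B1 & H1 & C1).
  assert (S1 := rotate_same_strands k a sg ltac:(lia)).
  destruct (proj1 (S1 (sg b)) ltac:(eauto)) as (d & Hd & Ed).
  assert (E0 : (0 + a) mod k = a) by (now apply Nat.mod_small).
  destruct d as [|d].
  - rewrite E0 in Ed. exfalso. apply Hab. now apply (proj1 (proj2 (proj2 C))).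
  - destruct (touch_zero d _ _ _ _ _ _ C1 ltac:(lia))
      as (n2 & g2 & sg2 & B2 & H2 & C2 & S2 & HT).
    exists n2, g2, sg2, B2. split; [auto|]. split; [auto|].
    split; [eapply same_strands_trans; eauto|].
    rewrite E0 in HT. replace (d + 1) with (S d) in HT by lia.
    rewrite Ed in HT. exact HT.
Qed.

(** Branch sets only grow, so contacts persist while further pairs are treated. *)
Lemma touch_list (ps : list (nat * nat)) : forall lb n g k sg B,
  config N R lb n g k sg B ->
  (forall a b, In (a, b) ps -> a <> b /\ (exists j, j < k /\ sg j = a) /\
                               (exists j, j < k /\ sg j = b)) ->
  exists n' g' sg' B', (forall i v, B i v -> B' i v) /\ config N R lb n' g' k sg' B' /\
    same_strands k sg sg' /\
    forall a b, In (a, b) ps -> exists u v, B' a u /\ B' b v /\ R u v.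
Proof.
  induction ps as [|[a b] ps IH]; intros lb n g k sg B C Hps.
  - exists n, g, sg, B. split; [auto|]. split; [auto|]. split; [now intros i|easy].
  - destruct (Hps a b (or_introl eq_refl)) as (Hab & (ja & Hja & Ea) & (jb & Hjb & Eb)).
    destruct (touch_slots _ _ _ _ _ _ ja jb C Hja Hjb) as
      (n1 & g1 & sg1 & B1 & H1 & C1 & S1 & u & v & Hu & Hv & Huv); [congruence|].
    destruct (IH _ _ _ _ _ _ C1) as (n2 & g2 & sg2 & B2 & H2 & C2 & S2 & HT).
    { intros a' b' Hin. destruct (Hps a' b' (or_intror Hin)) as (Hab' & Ha' & Hb').
      split; auto. split; now apply S1. }
    exists n2, g2, sg2, B2. split; [auto|]. split; [auto|].
    split; [eapply same_strands_trans; eauto|].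
    intros a' b' [E|Hin]; [|auto].
    injection E as <- <-. exists u, v. rewrite <- Ea, <- Eb. auto.
Qed.

Lemma add_strand lb n g k sg B i :
  config N R lb n g k sg B -> 1 <= k -> (forall j, j < k -> sg j <> i) ->
  exists n' g' sg' B', (forall i' v, i' <> i -> B i' v -> B' i' v) /\
    config N R lb n' g' (k + 1) sg' B' /\
    (forall j, j < k -> sg' j = sg j) /\ sg' k = i.
Proof.
  intros C Hk Hi.
  destruct (rotate_full N R G 1 _ _ _ _ _ _ C Hk) as (B1 & H1 & C1).
  rewrite Nat.mul_1_r in C1. set (n1 := n + k) in *. set (g1 := g + k) in *.
  destruct C as (Hg & _). destruct C1 as (Hg1 & Hlb & Hinj & HB & Hd).
  exists n1, g1, (fun j => if Nat.eq_dec j k then i else sg j),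
    (fun i' v => if Nat.eq_dec i' i then v = N ^ n1 * (g1 + k) else B1 i' v).
  pose proof (power_pos N R G n1) as HP.
  assert (Hend : N ^ n1 * g1 < N ^ n1 * (g1 + k)) by (apply Nat.mul_lt_mono_pos_l; lia).
  assert (Hnew : forall j, j < k -> ~ B1 (sg j) (N ^ n1 * (g1 + k))).
  { intros j Hj Hv. apply HB in Hv as [_ Hv]; auto. specialize (Hv ltac:(lia)).
    apply Nat.mul_cancel_l in Hv; lia. }
  split; [|split; [|split]].
  - intros i' v Hne Hv. destruct Nat.eq_dec; [lia|auto].
  - split; [unfold g1; lia|]. split; [lia|]. split; [|split].
    + intros j j' Hj Hj'. destruct (Nat.eq_dec j k), (Nat.eq_dec j' k); intros E; try lia.
      * exfalso. apply (Hi j'); [lia|auto].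
      * exfalso. apply (Hi j); [lia|auto].
      * apply Hinj; auto; lia.
    + intros j Hj. destruct (Nat.eq_dec j k) as [->|].
      * destruct (Nat.eq_dec i i); [|tauto]. split; [apply connected_point|].
        split; auto. intros v ->. split; auto. lia.
      * assert (Hj' : j < k) by lia. destruct (Nat.eq_dec (sg j) i) as [E|].
        { now destruct (Hi j). }
        apply HB; auto.
    + intros j j' v Hj Hj'.
      destruct (Nat.eq_dec j k) as [->|Hjk], (Nat.eq_dec j' k) as [->|Hjk']; auto.
      * destruct (Nat.eq_dec i i); [|tauto]. destruct (Nat.eq_dec (sg j') i) as [E|].
        { destruct (Hi j'); auto; lia. }
        intros -> Hv. destruct (Hnew j'); auto; lia.
      * destruct (Nat.eq_dec i i); [|tauto]. destruct (Nat.eq_dec (sg j) i) as [E|].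
        { destruct (Hi j); auto; lia. }
        intros Hv ->. destruct (Hnew j); auto; lia.
      * destruct (Nat.eq_dec (sg j) i) as [E|]; [destruct (Hi j); auto; lia|].
        destruct (Nat.eq_dec (sg j') i) as [E|]; [destruct (Hi j'); auto; lia|].
        apply Hd; lia.
  - intros j Hj. destruct Nat.eq_dec; auto; lia.
  - destruct Nat.eq_dec; auto; lia.
Qed.

End Touch.

(** * Lifting to the universal graph *)

(** The end [b] is kept out of [A], since it may belong to another branch set. *)
Lemma walk_conn (U : graph) (A : V U -> Prop) l : forall a b,
  walk_adj U (a :: l ++ [b]) -> A a -> (forall y, In y l -> A y) ->
  (forall y, In y l -> conn (adj U) A a y) /\
  exists y, A y /\ conn (adj U) A a y /\ adj U y b.
Proof.
  induction l as [|c l IH]; intros a b Hw Ha Hl.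
  - split; [easy|]. exists a. repeat split; auto using conn_refl. apply Hw.
  - rewrite <- app_comm_cons in Hw. apply walk_adj_cons in Hw as [Hac Hw].
    assert (Hc : A c) by (apply Hl; now left).
    destruct (IH c b Hw Hc) as [H1 (y & Hy & H2 & H3)]; [intros; apply Hl; now right|].
    split.
    + intros y' [<-|Hy']; [now apply conn_edge|].
      eapply conn_step; eauto.
    + exists y. repeat split; auto. eapply conn_step; eauto.
Qed.

Section Lift.

Variables (U : graph) (N : nat) (ga : nat -> bool) (f : nat -> V U).
Variables (X Z : nat -> nat) (L : nat -> list (V U)).
Hypothesis HN : 2 <= N.
Hypothesis Hf : embeds U N ga f.
Hypothesis HXZ : forall n, X n < Z n < X (n + 1).
Hypothesis Hnadj : forall n, ~ sadj N ga (X n) (Z n).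
Hypothesis Hwalk : forall n, walk_adj U (f (X n) :: L n ++ [f (Z n)]).
Hypothesis Hnew : forall n y, In y (L n) -> forall k, f k <> y.
Hypothesis Hdisj : forall n m y, In y (L n) -> In y (L m) -> n = m.

Definition jadj (a b : nat) : Prop :=
  sadj N ga a b \/ exists n, (a = X n /\ b = Z n) \/ (b = X n /\ a = Z n).

Lemma jadj_sym a b : jadj a b -> jadj b a.
Proof.
  intros [H|(n & [H|H])]; [left; now apply sadj_sym|right|right]; eauto.
Qed.

Lemma jump_far n : n <= X n.
Proof.
  induction n as [|n IH]; [lia|]. specialize (HXZ n). rewrite Nat.add_1_r in HXZ. lia.
Qed.

Lemma spiral_jump_grid : jump_grid N jadj.
Proof.
  split; auto using jadj_sym.
  - intros a Ha. left. now apply spiral_succ.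
  - intros a r Ha Hr. left. now apply spiral_child.
  (* The shift by 4 gives [x - 1 >= 3], where the edges of the spiral begin. *)
  - intros M. exists (X (M + 4)), (Z (M + 4)).
    assert (Hx := jump_far (M + 4)). specialize (HXZ (M + 4)). specialize (Hnadj (M + 4)).
    set (x := X (M + 4)) in *. set (z := Z (M + 4)) in *.
    assert (Hxz : z <> x + 1) by (intros E; apply Hnadj; rewrite E; apply spiral_succ; lia).
    split; [lia|]. split; [lia|]. split; [right; exists (M + 4); auto|].
    destruct (Nat.lt_trichotomy (z + 1) (N * x)) as [H|[H|H]]; auto.
    + right; left. split; auto. left; left. split; [auto|]. split; [lia|].
      right; right; left. split; [nia|].
      destruct (ga (x - 1)) eqn:E; auto. exfalso. apply Hnadj. left.
      split; [auto|]. split; [lia|]. auto.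
    + destruct (Nat.lt_trichotomy z (N * x + N)) as [H'|[H'|H']]; auto.
      * exfalso. apply Hnadj. left. split; [auto|]. split; [lia|].
        right; left. lia.
      * right; right; left. split; auto. left; left. split; [auto|]. split; [lia|].
        right; right; right. split; [nia|]. replace (x + 1 - 1) with x by lia.
        destruct (ga x) eqn:E; auto. exfalso. apply Hnadj. left.
        split; [auto|]. split; [lia|]. auto.
Qed.

(* The interior of a jump goes with its lower end. *)
Definition lift (A : nat -> Prop) (u : V U) : Prop :=
  (exists v, A v /\ u = f v) \/ (exists n, A (X n) /\ In u (L n)).

Lemma lift_image A v : A v -> lift A (f v).
Proof. left; eauto. Qed.

Lemma lift_avoids A v : lift A (f v) -> A v.
Proof.
  intros [(w & Hw & E)|(n & _ & Hin)].
  - apply Hf in E. congruence.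
  - now destruct (Hnew n _ Hin v).
Qed.

Lemma lift_disjoint A A' u :
  (forall v, A v -> A' v -> False) -> lift A u -> lift A' u -> False.
Proof.
  intros H [(v & Hv & ->)|(n & Hn & Hin)] HA'.
  - apply lift_avoids in HA'. eauto.
  - destruct HA' as [(w & _ & ->)|(m & Hm & Hin')]; [now destruct (Hnew n _ Hin w)|].
    assert (n = m) by eauto. subst. eauto.
Qed.

Lemma lift_jump A n : A (X n) ->
  (forall y, In y (L n) -> conn (adj U) (lift A) (f (X n)) y) /\
  exists y, lift A y /\ conn (adj U) (lift A) (f (X n)) y /\ adj U y (f (Z n)).
Proof.
  intros HA. apply walk_conn.
  - apply Hwalk.
  - now apply lift_image.
  - intros y Hy. right. eauto.
Qed.

Lemma lift_conn A a b : conn jadj A a b -> conn (adj U) (lift A) (f a) (f b).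
Proof.
  induction 1 as [a Ha|a c b Ha Hac Hcb IH]; [now apply conn_refl, lift_image|].
  assert (Hc : A c) by (eapply conn_left; eauto).
  eapply conn_trans; [|exact IH].
  destruct Hac as [H|(n & [[-> ->]|[-> ->]])].
  - apply conn_edge; auto using lift_image. now apply Hf.
  - destruct (lift_jump A n Ha) as [_ (y & Hy & H1 & H2)].
    eapply conn_trans; [exact H1|]. apply conn_edge; auto using lift_image.
  - destruct (lift_jump A n Hc) as [_ (y & Hy & H1 & H2)].
    apply conn_sym; [apply adj_sym|].
    eapply conn_trans; [exact H1|]. apply conn_edge; auto using lift_image.
Qed.

Lemma lift_connected A : connected jadj A -> connected (adj U) (lift A).
Proof.
  intros HA.
  assert (H : forall u, lift A u -> exists v, A v /\ conn (adj U) (lift A) (f v) u).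
  { intros u [(v & Hv & ->)|(n & Hn & Hin)].
    - exists v. split; auto. now apply conn_refl, lift_image.
    - exists (X n). split; auto. now apply lift_jump. }
  intros u w Hu Hw. destruct (H u Hu) as (a & Ha & Hau), (H w Hw) as (b & Hb & Hbw).
  eapply conn_trans; [apply conn_sym; [apply adj_sym|exact Hau]|].
  eapply conn_trans; [|exact Hbw]. apply lift_conn, HA; auto.
Qed.

Lemma lift_adjacent A A' a b : A a -> A' b -> jadj a b ->
  exists u v, lift A u /\ lift A' v /\ adj U u v.
Proof.
  intros Ha Hb [H|(n & [[-> ->]|[-> ->]])].
  - exists (f a), (f b). repeat split; auto using lift_image. now apply Hf.
  - destruct (lift_jump A n Ha) as [_ (y & Hy & _ & H)].
    exists y, (f (Z n)). auto using lift_image.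
  - destruct (lift_jump A' n Hb) as [_ (y & Hy & _ & H)].
    exists (f (Z n)), y. repeat split; auto using lift_image. now apply adj_sym.
Qed.

End Lift.

(** * The complete minor and the subdivisions *)

Record linkage : Type := Linkage {
  lk_n : nat; lk_g : nat; lk_k : nat; lk_sg : nat -> nat; lk_B : nat -> nat -> Prop
}.

Lemma complete_linkages N R : jump_grid N R ->
  exists B : nat -> nat -> Prop,
    (forall i, exists v, B i v) /\
    (forall i, connected R (B i)) /\
    (forall i j v, B i v -> B j v -> i = j) /\
    (forall i j, i <> j -> exists u v, B i u /\ B j v /\ R u v).
Proof.
  intros G.
  set (inv := fun s => config N R 0 (lk_n s) (lk_g s) (lk_k s) (lk_sg s) (lk_B s) /\
    1 <= lk_k s /\ forall i, (exists j, j < lk_k s /\ lk_sg s j = i) <-> i < lk_k s).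
  set (rel := fun s s' => lk_k s' = lk_k s + 1 /\
    (forall i v, i < lk_k s -> lk_B s i v -> lk_B s' i v) /\
    forall i, i < lk_k s -> exists u v, lk_B s' i u /\ lk_B s' (lk_k s) v /\ R u v).
  (* For one strand, 4 is the least base that [config] allows. Only the branch set of strand 0 has a
     meaning yet. *)
  destruct (dependent_choice inv rel) with
    (s0 := Linkage 0 4 1 (fun j => j) (fun i v => v = 4)) as (q & Hq0 & Hq).
  { intros [n g k sg B] (C & Hk & Hsg). unfold rel, inv; simpl in *.
    destruct (add_strand N R G _ _ _ _ _ _ k C Hk) as (n1 & g1 & sg1 & B1 & H1 & C1 & E1 & Ek).
    { intros j Hj E. specialize (proj1 (Hsg k)). intros H. specialize (H ltac:(eauto)). lia. }
    assert (Hsg1 : forall i, (exists j, j < k + 1 /\ sg1 j = i) <-> i < k + 1).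
    { intros i. split.
      - intros (j & Hj & <-). destruct (Nat.eq_dec j k) as [->|]; [lia|].
        rewrite E1 by lia. assert (sg j < k) by (apply Hsg; exists j; split; auto; lia). lia.
      - intros Hi. destruct (Nat.eq_dec i k) as [->|]; [exists k; split; auto; lia|].
        destruct (proj2 (Hsg i)) as (j & Hj & <-); [lia|].
        exists j. split; [lia|]. now apply E1. }
    destruct (touch_list N R G (map (fun i => (i, k)) (seq 0 k)) _ _ _ _ _ _ C1)
      as (n2 & g2 & sg2 & B2 & H2 & C2 & S2 & HT).
    { intros a b Hin. apply in_map_iff in Hin as (i & E & Hin). injection E as <- <-.
      apply in_seq in Hin. split; [lia|]. split; apply Hsg1; lia. }
    exists (Linkage n2 g2 (k + 1) sg2 B2). simpl.
    split; [split; [auto|split; [lia|]]|split; [auto|split]].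
    - intros i. rewrite <- (Hsg1 i). symmetry. apply S2.
    - intros i v Hi Hv. apply H2, H1; auto. lia.
    - intros i Hi. apply HT. apply in_map_iff. exists i. split; auto. apply in_seq. lia. }
  { unfold inv; simpl. split; [|split; [auto|]].
    - split; [auto|]. split; [lia|]. split; [auto|]. split.
      + intros j Hj. replace j with 0 by lia. split; [apply connected_point|].
        split; auto. intros v ->. simpl. split; lia.
      + intros; lia.
    - intros i. split; [intros (j & Hj & <-); lia|eauto]. }
  assert (Hk : forall n, lk_k (q n) = n + 1).
  { induction n as [|n IH]; [now rewrite Hq0|].
    destruct (Hq n) as [_ [E _]]. rewrite Nat.add_1_r in E. lia. }
  assert (Hmono : forall n m i v, n <= m -> i <= n -> lk_B (q n) i v -> lk_B (q m) i v).
  { intros n m i v Hnm Hi Hv. induction Hnm as [|m Hnm IH]; auto.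
    destruct (Hq m) as [_ (_ & H & _)]. rewrite Nat.add_1_r in H.
    apply H; auto. rewrite Hk. lia. }
  assert (Hslot : forall n i, i <= n -> exists j, j < lk_k (q n) /\ lk_sg (q n) j = i).
  { intros n i Hi. destruct (Hq n) as [(_ & _ & H) _]. apply H. rewrite Hk. lia. }
  (* The condition [i <= n] drops the stages at which strand [i] is not yet present and its set is a
     placeholder. *)
  exists (fun i v => exists n, i <= n /\ lk_B (q n) i v).
  split; [|split; [|split]].
  - intros i. destruct (Hslot i i (le_n i)) as (j & Hj & E).
    destruct (Hq i) as [((_ & _ & _ & H & _) & _) _].
    destruct (H j Hj) as (_ & He & _). rewrite E in He. eauto.
  - intros i a b (n & Hn & Ha) (m & Hm & Hb).
    set (p := Nat.max n m).
    destruct (Hslot p i) as (j & Hj & E); [lia|].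
    destruct (Hq p) as [((_ & _ & _ & H & _) & _) _].
    destruct (H j Hj) as (Hc & _). rewrite E in Hc.
    apply (conn_mono R (lk_B (q p) i)); [intros v Hv; exists p; split; auto; lia|].
    apply Hc; [apply (Hmono n)|apply (Hmono m)]; auto; lia.
  - intros i i' v (n & Hn & Ha) (m & Hm & Hb).
    set (p := Nat.max n m).
    destruct (Hslot p i) as (j & Hj & E); [lia|].
    destruct (Hslot p i') as (j' & Hj' & E'); [lia|].
    destruct (Hq p) as [((_ & _ & _ & _ & H) & _) _].
    rewrite <- E, <- E'. f_equal. apply (H j j' v); auto; rewrite ?E, ?E'.
    + apply (Hmono n); auto; lia.
    + apply (Hmono m); auto; lia.
  - assert (HT : forall i j, i < j -> exists u v, (exists n, i <= n /\ lk_B (q n) i u) /\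
                (exists n, j <= n /\ lk_B (q n) j v) /\ R u v).
    { intros i j Hij. destruct (Hq (j - 1)) as [_ (_ & _ & H)].
      rewrite Hk in H. replace (j - 1 + 1) with j in H by lia.
      destruct (H i Hij) as (u & v & Hu & Hv & Huv).
      exists u, v. repeat split; auto; exists j; split; auto; lia. }
    intros i j Hij. destruct (Nat.lt_trichotomy i j) as [Lt|[Lt|Lt]]; auto; [tauto|].
    destruct (HT j i Lt) as (u & v & Hu & Hv & Huv). exists v, u.
    repeat split; auto. now apply (jg_sym _ _ G).
Qed.

Lemma universal_minor (U : graph) :
  (forall G, planar G -> contains U G) -> minor Kinf U.
Proof.
  intros HU.
  destruct (spiral_with_jumps U 2 HU (le_n 2))
    as (ga & f & X & Z & L & Hf & HXZ & Hna & Hw & Hnew & Hd).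
  destruct (complete_linkages 2 _
    (spiral_jump_grid 2 ga X Z (le_n 2) HXZ Hna)) as (B & H1 & H2 & H3 & H4).
  exists (fun i => lift U f X L (B i)). split; [|split; [|split]].
  - intros i. destruct (H1 i) as [v Hv]. exists (f v). now apply lift_image.
  - intros i j u Hi Hj. apply NNPP. intros Hij.
    eapply (lift_disjoint U 2 ga f X L); eauto.
  - intros i. apply connected_connected_in.
    apply (lift_connected U 2 ga f X Z L); auto.
  - intros i j Hij. destruct (H4 i j Hij) as (a & b & Ha & Hb & Hab).
    eapply (lift_adjacent U 2 ga f X Z L); eauto.
Qed.

(** The hubs are the vertices [f (M + i)]. Strand [N * i + j] starts at child [j] of hub [i] and is
    reserved for the path to hub [j]; its contact with strand [N * j + i] closes that path. *)
Lemma universal_subdivision (U : graph) (t : nat) :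
  (forall G, planar G -> contains U G) -> contains_subdivision_K U t.
Proof.
  intros HU. set (N := t + 2).
  assert (HN : 2 <= N) by (unfold N; lia).
  destruct (spiral_with_jumps U N HU HN)
    as (ga & f & X & Z & L & Hf & HXZ & Hna & Hw & Hnew & Hd).
  assert (G := spiral_jump_grid N ga X Z HN HXZ Hna).
  set (R := jadj N ga X Z) in *.
  (* Large enough for a bunch of [N * t] strands on base [N * M]. The hubs lie below [N * M], the
     lower bound of all branch sets, so no strand runs through a hub. *)
  set (M := t + 5).
  assert (C : config N R (N * M) 0 (N * M) (N * t) (fun j => j) (fun i v => v = N * M + i)).
  { split; [unfold M; nia|]. split; [simpl; lia|]. split; [auto|]. split.
    - intros j Hj. split; [apply connected_point|]. simpl. split; [lia|].
      intros v ->. lia.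
    - intros; lia. }
  assert (slot : forall i j, i < t -> j < t -> N * i + j < N * t) by (unfold N; nia).
  assert (uniq : forall i j i' j', j < t -> j' < t -> N * i + j = N * i' + j' ->
                   i = i' /\ j = j').
  { intros i j i' j' Hj Hj' E.
    apply (Nat.div_mod_unique N); unfold N in *; lia. }
  destruct (touch_list N R G (map (fun p => (N * fst p + snd p, N * snd p + fst p))
     (filter (fun p => fst p <? snd p) (list_prod (seq 0 t) (seq 0 t)))) _ _ _ _ _ _ C)
    as (n & g & sg & B & H1 & C1 & S1 & HT).
  { intros a b Hin. apply in_map_iff in Hin as ([i j] & E & Hin). simpl in E.
    injection E as <- <-. apply filter_In in Hin as [Hin Hlt].
    apply Nat.ltb_lt in Hlt. simpl in Hlt. apply in_prod_iff in Hin as [Hi Hj].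
    apply in_seq in Hi, Hj. split; [|split; eexists; split; eauto; apply slot; lia].
    intros E. apply uniq in E; lia. }
  assert (touch : forall i j, i < j -> j < t ->
    exists u v, B (N * i + j) u /\ B (N * j + i) v /\ R u v).
  { intros i j Hij Hj. apply HT, in_map_iff. exists (i, j). split; auto.
    apply filter_In. split; [apply in_prod; apply in_seq; lia|]. now apply Nat.ltb_lt. }
  destruct C1 as (_ & _ & _ & HB & HBd).
  assert (strand : forall i j, i < t -> j < t ->
    connected R (B (N * i + j)) /\ B (N * i + j) (N * (M + i) + j) /\
    forall v, B (N * i + j) v -> N * M <= v).
  { intros i j Hi Hj. destruct (proj1 (S1 (N * i + j))) as (s & Hs & Es); [eauto|].
    destruct (HB s Hs) as (K1 & _ & K2). rewrite Es in K1, K2. split; auto. split.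
    - apply H1. lia.
    - intros v Hv. now apply K2. }
  assert (apart : forall i j i' j' v, i < t -> j < t -> i' < t -> j' < t ->
    B (N * i + j) v -> B (N * i' + j') v -> i = i' /\ j = j').
  { intros i j i' j' v Hi Hj Hi' Hj' Hv Hv'. apply uniq; auto.
    destruct (proj1 (S1 (N * i + j))) as (s & Hs & Es); [eauto|].
    destruct (proj1 (S1 (N * i' + j'))) as (s' & Hs' & Es'); [eauto|].
    rewrite <- Es, <- Es'. f_equal. apply (HBd s s' v); congruence. }
  set (T := fun i j => lift U f X L (B (N * i + j))).
  assert (T_hub : forall i j k, i < t -> j < t -> k < t -> ~ T i j (f (M + k))).
  { intros i j k Hi Hj Hk H. apply (lift_avoids U N ga f X L) in H; auto.
    apply strand in H; auto. unfold N, M in H. nia. }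
  assert (T_apart : forall i j i' j' u, i < t -> j < t -> i' < t -> j' < t ->
    T i j u -> T i' j' u -> i = i' /\ j = j').
  { intros i j i' j' u Hi Hj Hi' Hj' H H'. apply NNPP. intros Hne.
    eapply (lift_disjoint U N ga f X L); [exact Hf|exact Hnew|exact Hd| |exact H|exact H'].
    intros v Hv Hv'. apply Hne. eauto. }
  assert (T_conn : forall i j, i < t -> j < t ->
    connected (adj U) (fun u => u = f (M + i) \/ T i j u)).
  { intros i j Hi Hj. destruct (strand i j Hi Hj) as (K1 & K2 & _).
    apply (connected_join (adj U) _ _ (f (M + i)) (f (N * (M + i) + j))).
    - apply adj_sym.
    - intros ? ? -> ->. now apply conn_refl.
    - apply (lift_connected U N ga f X Z L); auto.
    - auto.
    - now apply lift_image.
    - right. apply Hf. apply spiral_child; unfold N, M; lia. }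
  assert (HP : forall i j, exists l, i < j < t ->
    is_path U l (f (M + i)) (f (M + j)) /\
    Forall (fun u => (u = f (M + i) \/ T i j u) \/ (u = f (M + j) \/ T j i u)) l).
  { intros i j. destruct (classic (i < j < t)) as [Hij|]; [|exists []; tauto].
    destruct (touch i j) as (a & b & Ha & Hb & Hab); try lia.
    destruct (lift_adjacent U N ga f X Z L Hf Hw (B (N * i + j)) (B (N * j + i)) a b)
      as (u & v & Hu & Hv & Huv); auto.
    destruct (conn_path U (fun u => (u = f (M + i) \/ T i j u) \/ (u = f (M + j) \/ T j i u))
      (f (M + i)) (f (M + j))) as (l & Hl & HS).
    - apply (connected_join (adj U) _ _ u v); auto; try (apply T_conn; lia).
      apply adj_sym.
    - exists l. auto. }
  set (P := fun i j => proj1_sig (constructive_indefinite_description _ (HP i j))).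
  assert (HPs : forall i j, i < j < t ->
    is_path U (P i j) (f (M + i)) (f (M + j)) /\
    forall v, In v (Defs.interior (P i j)) -> T i j v \/ T j i v).
  { intros i j Hij.
    destruct (proj2_sig (constructive_indefinite_description _ (HP i j)) Hij) as [K1 K2].
    split; [exact K1|]. intros v Hv.
    destruct (path_interior _ _ _ _ _ K1 Hv) as (Hv1 & Hv2 & Hv3).
    rewrite Forall_forall in K2. specialize (K2 v Hv1). tauto. }
  exists (fun i => f (M + i)), P. split; [|split; [|split]].
  - intros i j _ _ E. apply Hf in E. lia.
  - intros i j Hij. now apply HPs.
  - intros i j k Hij Hk Hin. apply HPs in Hin; auto.
    destruct Hin as [Hin|Hin]; eapply T_hub; try exact Hin; lia.
  - intros i j i' j' v Hij Hij' Hne Hv Hv'.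
    apply HPs in Hv, Hv'; auto. apply Hne.
    destruct Hv as [Hv|Hv], Hv' as [Hv'|Hv'];
      destruct (fun a b c d => T_apart _ _ _ _ v a b c d Hv Hv') as [E1 E2];
      try lia; f_equal; lia.
Qed.

Theorem theorem1 :
  forall U : graph,
    (forall G : graph, planar G -> contains U G) ->
    minor Kinf U /\ (forall t : nat, contains_subdivision_K U t).
Proof.
  intros U HU. split; [now apply universal_minor|].
  intros t. now apply universal_subdivision.
Qed.
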